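(* Let $p\ge2$ be real and let $N$ be an integer with $N\ge 1+p(p-1)$. Set $\Lambda_p:=\left(\frac{N-1}{p}\right)^p$ and $r:=\varrho(x,x_0)$ with $x_0\in\mathbb{H}^N$ fixed. Then for all $u\in C_c^\infty(\mathbb{H}^N)$ $$\int_{\mathbb{H}^N}|\nabla_{\mathbb{H}^N}u|^p\,{\rm d}v_{\mathbb{H}^N}-\Lambda_p\int_{\mathbb{H}^N}|u|^p\,{\rm d}v_{\mathbb{H}^N}\ \ge\ (p-1)\left(\frac{N-1}{p}\right)^{p-2}\left(\frac{p-1}{p}\right)^2\int_{\mathbb{H}^N}\frac{|u|^p}{r^p}\,{\rm d}v_{\mathbb{H}^N}.$$
   Context: $\mathbb{H}^N$ is the hyperbolic space of dimension $N$ (constant sectional curvature $-1$); $\nabla_{\mathbb{H}^N}$ and ${\rm d}v_{\mathbb{H}^N}$ denote its Riemannian gradient and Riemannian measure, and $|\nabla_{\mathbb{H}^N}u|$ is the Riemannian norm of the gradient. $\varrho(x,x_0)$ is the geodesic distance between $x$ and $x_0$. *)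

(* Defs.v *)
From HB Require Import structures.
From mathcomp Require Import all_boot all_order all_algebra.
From mathcomp Require Import all_classical all_reals all_analysis.

Set Implicit Arguments.
Unset Strict Implicit.
Unset Printing Implicit Defensive.
Import Order.TTheory GRing.Theory Num.Theory.
Import numFieldNormedType.Exports.

Local Open Scope classical_set_scope.
Local Open Scope ring_scope.

Section lebesgue_measure_tuple.
Context {R : realType}.
Local Open Scope ereal_scope.

Definition cons_pair n (p : measurableTypeR R * n.-tuple (measurableTypeR R)) :
  n.+1.-tuple (measurableTypeR R) := [tuple of p.1 :: p.2].

Lemma measurable_cons_pair n : measurable_fun [set: _] (@cons_pair n).
Proof. exact: measurable_cons. Qed.

(* Lebesgue measure on R^n, as the n-fold product of the Lebesgue measure on R
   (the library has only binary products of measures). *)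
Fixpoint lebesgue_tuple n : set (n.-tuple (measurableTypeR R)) -> \bar R :=
  if n is n'.+1 then
    pushforward (@lebesgue_measure R \x @lebesgue_tuple n') (@cons_pair n')
  else dirac [tuple].

Let uncons n (t : n.+1.-tuple (measurableTypeR R)) :
  measurableTypeR R * n.-tuple (measurableTypeR R) :=
  (thead t, [tuple of behead t]).

Let measurable_uncons n : measurable_fun [set: _] (@uncons n).
Proof.
apply/measurable_fun_pairP; split.
  exact: (measurable_tnth ord0).
exact: measurable_behead.
Qed.

Let lebesgue_tuple_measure n :
  exists m : {sigma_finite_measure set (n.-tuple (measurableTypeR R)) -> \bar R},
    (m : set _ -> \bar R) = @lebesgue_tuple n.
Proof.
elim: n => [|n [m mE]].
  by exists (dirac [tuple]).
pose Q_ : {measure set (n.+1.-tuple (measurableTypeR R)) -> \bar R} :=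
  pushforward (@lebesgue_measure R \x m) (@cons_pair n).
pose Q := Q_ (@measurable_cons_pair n).
have Qsf : sigma_finite setT Q.
  have /sigma_finiteP[F [TF ndF Foo]] := sigma_finiteT (@lebesgue_measure R).
  have /sigma_finiteP[G [TG ndG Goo]] := sigma_finiteT m.
  exists (fun k => @uncons n @^-1` (F k `*` G k)).
    rewrite -preimage_bigcup (_ : \bigcup_k _ = setT) ?preimage_setT//.
    apply/seteqP; split=> // -[x y] _.
    have [k _ Fkx] : (\bigcup_k F k) x by rewrite -TF.
    have [l _ Gly] : (\bigcup_k G k) y by rewrite -TG.
    exists (maxn k l) => //; split.
      by move: x Fkx; exact/subsetPset/ndF/leq_maxl.
    by move: y Gly; exact/subsetPset/ndG/leq_maxr.
  move=> k; have [mF Fk] := Foo k; have [mG Gk] := Goo k; split.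
    by rewrite -[X in measurable X]setTI; apply: measurable_uncons => //;
      exact: measurableX.
  rewrite [Q _](_ : _ = (@lebesgue_measure R \x m) (F k `*` G k)).
    by rewrite product_measure1E// lte_mul_pinfty// ge0_fin_numE.
  rewrite /Q /Q_ /=; congr (product_measure1 _ _ _).
  have consK : cancel (@cons_pair n) (@uncons n).
    by move=> [a b]; congr pair; exact/val_inj.
  have E z : (F k `*` G k) (@uncons n (@cons_pair n z)) = (F k `*` G k) z.
    by rewrite consK.
  exact/funext/E.
pose S := Measure_isSigmaFinite.Build _ _ _ Q Qsf.
pose Q' : {sigma_finite_measure set _ -> \bar R} :=
  HB.pack (Q : set _ -> \bar R) (Measure.class Q) S.
by exists Q'; rewrite /= -mE.
Qed.

Let lebesgue_tuple0 n : @lebesgue_tuple n set0 = 0.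
Proof. by have [m <-] := lebesgue_tuple_measure n; exact: measure0. Qed.

Let lebesgue_tuple_ge0 n A : 0 <= @lebesgue_tuple n A.
Proof. by have [m <-] := lebesgue_tuple_measure n; exact: measure_ge0. Qed.

Let lebesgue_tuple_sigma_additive n : semi_sigma_additive (@lebesgue_tuple n).
Proof.
by have [m <-] := lebesgue_tuple_measure n; exact: measure_semi_sigma_additive.
Qed.

HB.instance Definition _ n := isMeasure.Build _ _ _ (@lebesgue_tuple n)
  (@lebesgue_tuple0 n) (@lebesgue_tuple_ge0 n) (@lebesgue_tuple_sigma_additive n).

Let lebesgue_tuple_sigma_finite n : sigma_finite setT (@lebesgue_tuple n).
Proof. by have [m <-] := lebesgue_tuple_measure n; exact: sigma_finiteT. Qed.

HB.instance Definition _ n := Measure_isSigmaFinite.Build _ _ _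
  (@lebesgue_tuple n) (@lebesgue_tuple_sigma_finite n).

End lebesgue_measure_tuple.

Definition vec_of_tuple {R : realType} {n}
  (t : n.-tuple (measurableTypeR R)) : 'rV[R]_n := \row_i tnth t i.

Section test_functions.
Context {R : realType} {n : nat}.
Implicit Types (u : 'rV[R]_n -> R) (U : set 'rV[R]_n).

Definition partial (i : 'I_n) u : 'rV[R]_n -> R :=
  fun x => 'D_(delta_mx 0 i) u x.

(* C^oo: all iterated partial derivatives exist and are continuous *)
Definition smooth u := forall s : seq 'I_n,
  continuous (foldr partial u s) /\
  forall i x, derivable (foldr partial u s) x (delta_mx 0 i).

(* C_c^oo(U), for U open: functions are extended by 0 outside U *)
Definition test_function U u :=
  [/\ smooth u, compact (closure [set x | u x != 0])
    & closure [set x | u x != 0] `<=` U].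

End test_functions.

(* Riemannian geometry of an open set U of R^n (a single global chart) for the
   metric tensor with Gram matrix [g x] at x. *)
Section riemannian.
Context {R : realType} {n : nat}.
Variables (g : 'rV[R]_n -> 'M[R]_n) (U : set 'rV[R]_n).

Definition riem_inner (x v w : 'rV[R]_n) : R := (v *m g x *m w^T) 0 0.

Definition riem_norm (x v : 'rV[R]_n) : R := Num.sqrt (riem_inner x v v).

(* grad u = g^{-1} du *)
Definition riem_grad (u : 'rV[R]_n -> R) (x : 'rV[R]_n) : 'rV[R]_n :=
  (\row_i partial i u x) *m invmx (g x).

(* dv = sqrt (det g) dx *)
Definition riem_integral (f : 'rV[R]_n -> R) : \bar R :=
  (\int[@lebesgue_tuple R n]_(t in vec_of_tuple @^-1` U)
    (f (vec_of_tuple t) * Num.sqrt (\det (g (vec_of_tuple t))))%:E)%E.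

Definition C1_curve (x y : 'rV[R]_n) (c : R -> 'rV[R]_n) :=
  [/\ forall t, derivable c t 1, continuous (derive1 c),
      forall t, 0 <= t <= 1 -> U (c t), c 0 = x & c 1 = y].

Definition riem_length (c : R -> 'rV[R]_n) : R :=
  \int[lebesgue_measure]_(t in `[0, 1]) riem_norm (c t) (derive1 c t).

(* Geodesic distance; C^1 curves (possibly with vanishing velocity) give the
   same infimum as piecewise C^1 ones. *)
Definition riem_dist (x y : 'rV[R]_n) : R :=
  inf [set riem_length c | c in C1_curve x y].

End riemannian.

(* Hyperbolic space of dimension n, in the Poincare ball model: the open unit
   ball with the metric 4 |dx|^2 / (1 - |x|^2)^2, of curvature -1. The norm
   of the library on row vectors is the sup norm, whence [sqnorm2]. *)
Section hyperbolic.
Context {R : realType} {n : nat}.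

Definition sqnorm2 (x : 'rV[R]_n) : R := \sum_i x 0 i ^+ 2.

Definition hyp_space : set 'rV[R]_n := [set x | sqnorm2 x < 1].

Definition hyp_metric (x : 'rV[R]_n) : 'M[R]_n :=
  ((2 / (1 - sqnorm2 x)) ^+ 2)%:M.

Definition hyp_norm := riem_norm hyp_metric.
Definition hyp_grad := riem_grad hyp_metric.
Definition hyp_integral := riem_integral hyp_metric hyp_space.
Definition hyp_dist := riem_dist hyp_metric hyp_space.

End hyperbolic.

Arguments hyp_space : clear implicits.

(* Main.v *)
Require Import Defs.
From mathcomp Require Import all_boot all_order all_algebra.
From mathcomp Require Import all_classical all_reals all_analysis.
From mathcomp Require Import measurable_realfun ring lra.
Set Implicit Arguments.
Unset Strict Implicit.
Unset Printing Implicit Defensive.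
Import Order.TTheory GRing.Theory Num.Theory.
Import numFieldNormedType.Exports.
Local Open Scope classical_set_scope.
Local Open Scope ring_scope.

(**
Write a = (N-1)/p, so that a >= p-1 by hypothesis, b = (p-1)/p, and let rho be
the distance to x0, whose Laplacian is (N-1) coth rho. For every vector field
f(rho) grad rho with f >= 0, integrating its divergence against |u|^p gives
<<
  int (f' + (N-1) coth(rho) f) |u|^p <= p int f |u|^(p-1) |grad u|.
>>
The right-hand side is absorbed by an affine lower bound p f z - K of the convex
function z |-> z^p, taken at z = |grad u| / |u|, where f and K depend on rho
only. For z >= 0 and A > 0 Bernoulli's inequality yields (powR_quadratic)
<<
  z^p >= A^p + p A^(p-1) (z - A) + (p-1) A^(p-2) (z - A)^2.
>>
Take A = a coth rho, which makes the first two terms account for the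
Poincare constant a^p. In the last one coth rho >= 1/rho gives
A^(p-2) >= (a/rho)^(p-2), and (z - A)^2 >= - 2 (b/rho)(z - A) - (b/rho)^2;
this is the step that produces a one-dimensional Hardy inequality with weight
rho^(2-p). Altogether z^p >= p f z - K with
<<
  f = (a coth rho)^(p-1) - (2 b^2 / a) (a/rho)^(p-1),
>>
which is nonnegative because a >= p-1 >= 2 b^2, and a direct computation shows
f' + (N-1) coth(rho) f - K >= a^p + (p-1) a^(p-2) b^2 rho^(-p), where
a >= p-1 is used once more. This is flux_pointwise.

In the ball model the function P = cosh rho is rational, with
|grad P|^2 = P^2 - 1 and div grad P = N P, and grad P is a polynomial field;
so the field f grad rho is written as W(P) grad P with W = f / sinh rho. It is
singular at x0, and is multiplied by a C^1 cutoff chi(P) which vanishes near x0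
and is nondecreasing in P. The extra divergence chi' f is nonnegative, so the
cutoff costs nothing, and monotone convergence removes it (weight_pointwise,
integral_div_test, poincare_hardy_arcosh).

Finally the Riemannian distance enters only through 1/r^p on the smaller side,
so that only the bound r >= rho is needed: along a C^1 curve, arcosh (P + e) is
smooth and its derivative is at most the speed (hyp_dist_ge).
*)

(** * Lebesgue measure on tuples *)

Section tuples.
Context {R : realType}.

(** The sigma-algebra on tuples is generated by the coordinates, hence contains
the open boxes; an open set is the union of the countably many rational boxes
that it contains. *)
Lemma measurable_preimage_open n (U : set 'rV[R]_n) : open U ->
  measurable (@vec_of_tuple R n @^-1` U).
Proof.
move=> oU.
pose box (qk : {ffun 'I_n -> rat} * nat) : set (n.-tuple (measurableTypeR R)) :=
  \bigcap_(i in [set: 'I_n])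
    ((@tnth n (measurableTypeR R))^~ i @^-1` ball (ratr (qk.1 i) : R) (qk.2.+1%:R^-1)).
pose F qk := if `[< box qk `<=` @vec_of_tuple R n @^-1` U >] then box qk else set0.
have -> : @vec_of_tuple R n @^-1` U = \bigcup_qk F qk.
  apply/seteqP; split => [t /= Ut|t [qk _]]; last first.
    by rewrite /F; case: asboolP => // + bt => /(_ _ bt).
  have /nbhs_ballP[e /= e0 eU] := open_nbhs_nbhs (conj oU Ut).
  have [k ke] : exists k : nat, k.+1%:R^-1 < e / 2.
    have [k _ /(_ k (leqnn k))] :=
      near_infty_natSinv_lt (PosNum (divr_gt0 e0 (ltr0Sn R 1))).
    by move=> /= h; exists k.
  have q_ (i : 'I_n) : {q : rat |
      ratr q \in `](tnth t i - k.+1%:R^-1), (tnth t i + k.+1%:R^-1)[}.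
    apply: cid; apply: rat_in_itvoo.
    by rewrite ltrBlDr -addrA ltrDl addr_gt0.
  pose q := [ffun i => sval (q_ i)].
  have tq i : ball (ratr (q i) : R) k.+1%:R^-1 (tnth t i).
    rewrite /ball /= ffunE; case: (q_ i) => r /=.
    move: (tnth t i : R) (k.+1%:R^-1 : R) => x y; rewrite in_itv /= => /andP[h1 h2].
    by rewrite ltr_norml; apply/andP; split; lra.
  exists (q, k) => //; rewrite /F; case: asboolP => [_|]; first by move=> i _; exact: tq.
  case=> s bs; apply: eU; split => // i j /=; rewrite !mxE.
  have := bs j Logic.I; have := tq j; rewrite /ball /= => h1 h2.
  move: h1 h2; move: (tnth t j : R) (tnth s j : R) (ratr (q j) : R) => x y z h1 h2.
  have -> : x - y = (z - y) - (z - x) by ring.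
  apply: (le_lt_trans (ler_normB _ _)).
  by move: h1 h2 ke; rewrite /ball_; set k1 := k.+1%:R^-1; lra.
apply: countable_bigcupT_measurable => // qk.
rewrite /F; case: asboolP => // _.
apply: fin_bigcap_measurable => // i _; rewrite -[X in measurable X]setTI.
by apply: (@measurable_tnth _ (measurableTypeR R)) => //;
  exact: measurable_realfun.measurable_ball.
Qed.

Lemma measurable_continuous_tuple n (g : 'rV[R]_n -> R) : continuous g ->
  measurable_fun [set: n.-tuple (measurableTypeR R)] (g \o @vec_of_tuple R n).
Proof.
move=> /continuousP cg;
  apply: (measurability _ (measurable_realfun.RGenOpens.measurableE R)).
move=> _ [_ [a [b ->] <-]]; rewrite setTI.
rewrite comp_preimage; apply: measurable_preimage_open; apply: cg; exact: interval_open.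
Qed.


(** The same cube as [in_cube] below, on the side of the measure space. *)
Definition cube (M : R) n : set (n.-tuple (measurableTypeR R)) :=
  [set t | forall i, `|tnth t i : R| <= M].

Arguments cube : clear implicits.

Lemma measurable_cube M n : measurable (cube M n).
Proof.
rewrite (_ : cube M n = \bigcap_(i in [set: 'I_n])
    ((@tnth n (measurableTypeR R))^~ i @^-1` [set` `[(- M), M]])); last first.
  apply/seteqP; split => [t h i _|t h i] /=; first by rewrite in_itv /= -ler_norml;
    exact: h.
  by have := h i Logic.I; rewrite /= in_itv /= -ler_norml.
apply: fin_bigcap_measurable => // i _; rewrite -[X in measurable X]setTI.
by apply: (@measurable_tnth _ (measurableTypeR R)).
Qed.

Lemma lebesgue_tuple_cube_lty M n : (@lebesgue_tuple R n (cube M n) < +oo)%E.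
Proof.
elim: n => [|n IH]; first by rewrite /= diracE; case: (_ \in _); rewrite ltry.
rewrite /= /pushforward.
rewrite (_ : _ @^-1` _ = [set` `[(- M), M]] `*` cube M n); last first.
  apply/seteqP; split => [[x t] /= h|[x t] /= [hx h]].
    split; first by have := h ord0; rewrite (tnth_nth x) /= in_itv /= -ler_norml.
    by move=> i; have := h (lift ord0 i); rewrite tnthS.
  move=> i; case: (unliftP ord0 i) => [j|] ->; first by rewrite tnthS; exact: h.
  by move: hx; rewrite (tnth_nth x) /= in_itv /= -ler_norml.
rewrite [X in (X < _)%E](product_measure1E (lebesgue_measure) (@lebesgue_tuple R n)) //;
  last first.
  exact: measurable_cube.
have h : (@lebesgue_measure R [set` (`[(- M), M])%R] < +oo)%E.
  by rewrite lebesgue_measure_itv /=; case: ifP; rewrite -?EFinB ltry.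
by apply: lte_mul_pinfty => //; rewrite ge0_fin_numE ?measure_ge0.
Qed.

Lemma measurable_set1_tuple n (s : n.-tuple (measurableTypeR R)) :
  measurable [set s].
Proof.
rewrite (_ : [set s] = \bigcap_(i in [set: 'I_n])
  ((@tnth n (measurableTypeR R))^~ i @^-1` [set (tnth s i)])); last first.
  apply/seteqP; split => [_ -> //|u h /=].
  by apply: eq_from_tnth => i; exact: h.
apply: fin_bigcap_measurable => // i _; rewrite -[X in measurable X]setTI.
by apply: (@measurable_tnth _ (measurableTypeR R)).
Qed.

Lemma lebesgue_tuple_set1 n (t : n.-tuple (measurableTypeR R)) : (0 < n)%N ->
  @lebesgue_tuple R n [set t] = 0%E.
Proof.
case: n t => // n t _; rewrite /= /pushforward.
rewrite (_ : _ @^-1` _ = [set thead t] `*` [set [tuple of behead t]]); last first.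
  apply/seteqP; split => [[x s] /= <-|[x s] /= [-> ->]].
    by split=> //; apply/val_inj.
  by rewrite /cons_pair /= [RHS]tuple_eta.
rewrite [LHS](product_measure1E (lebesgue_measure) (@lebesgue_tuple R n)) //; last first.
  exact: measurable_set1_tuple.
rewrite [X in (X * _)%E](_ : _ = 0%E) ?mul0e //.
exact: lebesgue_measure_set1.
Qed.

End tuples.
Arguments cube {R} M n t : rename.

Lemma integrable_bounded_support d (T : measurableType d) (R : realType)
  (mu : {measure set T -> \bar R}) (A : set T) (g : T -> R) (K : R) :
  measurable A -> (mu A < +oo)%E -> measurable_fun [set: T] g ->
  (forall x, `|g x| <= K) -> (forall x, ~ A x -> g x = 0) ->
  mu.-integrable [set: T] (EFin \o g).
Proof.
move=> mA Aoo mg gK g0.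
have -> : EFin \o g = (EFin \o g) \_ A.
  apply/funext => x; rewrite patchE; case: ifPn => //.
  by rewrite notin_setE => /g0 /= ->.
apply/(integrable_mkcond _ mA).
apply: (measurable_bounded_integrable mA Aoo); first exact: measurable_funTS.
exists K; split; first by rewrite num_real.
by move=> y Ky x _ /=; apply: le_trans (gK x) (ltW Ky).
Qed.

Section slices.
Context {R : realType}.
Local Notation mu := (@lebesgue_measure R).

(** Moving the [i]-th coordinate alone: the lines parallel to the axes. *)
Definition upd n (t : n.-tuple (measurableTypeR R)) (i : 'I_n) (s : R) :
  n.-tuple (measurableTypeR R) :=
  [tuple (if j == i then s else tnth t j) | j < n].

Lemma upd_cons n x (t : n.-tuple (measurableTypeR R)) i s :
  upd (cons_pair (x, t)) (lift ord0 i) s = cons_pair (x, upd t i s).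
Proof.
apply: eq_from_tnth => j; rewrite tnth_mktuple.
case: (unliftP ord0 j) => [k|] ->.
  by rewrite (inj_eq lift_inj) !tnthS tnth_mktuple.
by rewrite (negbTE (neq_lift _ _)) !(tnth_nth x).
Qed.

Lemma upd0_cons n x (t : n.-tuple (measurableTypeR R)) s :
  upd (cons_pair (x, t)) ord0 s = cons_pair (s, t).
Proof.
apply: eq_from_tnth => j; rewrite tnth_mktuple.
case: (unliftP ord0 j) => [k|] ->.
  by rewrite eq_sym (negbTE (neq_lift _ _)) !tnthS.
by rewrite eqxx.
Qed.

(** Fubini, by induction on the dimension: the first coordinate is integrated
first if it is the one along which the integral vanishes, and last otherwise. *)
Lemma integral_slices0 n (i : 'I_n) (M K : R)
    (g : n.-tuple (measurableTypeR R) -> R) :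
  measurable_fun [set: _] g -> (forall t, `|g t| <= K) ->
  (forall t, ~ cube M n t -> g t = 0) ->
  (forall t, (\int[mu]_s (g (upd t i s))%:E = 0)%E) ->
  (\int[@lebesgue_tuple R n]_t (g t)%:E = 0)%E.
Proof.
elim: n i g => [[] //|n IH] i g mg gK g0 gi.
pose P := (@lebesgue_measure R \x @lebesgue_tuple R n)%E.
have mc : measurable (@cons_pair R n @^-1` cube M n.+1).
  rewrite -[X in measurable X]setTI.
  by apply: (@measurable_cons_pair R n) => //; exact: measurable_cube.
have mgc : measurable_fun [set: _] (g \o @cons_pair R n).
  by apply: measurableT_comp => //; exact: measurable_cons_pair.
have ig : P.-integrable [set: _] (EFin \o (g \o @cons_pair R n)).
  apply: (@integrable_bounded_support _ _ _ _ _ _ K mc) => //.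
  - exact: (@lebesgue_tuple_cube_lty R M n.+1).
  - by move=> x; exact: gK.
  - by move=> x /g0.
transitivity (\int[P]_z (g (cons_pair z))%:E)%E.
  rewrite (@integral_pushforward _ _ _ _ R _ (@measurable_cons_pair R n) P setT
    (EFin \o g)) //.
  exact/measurable_EFinP.
case: (unliftP ord0 i) => [j|] ei; rewrite {}ei in gi *.
  rewrite -(integral12_prod_meas1 ig) /fubini_F.
  apply: integral0_eq => x _ /=.
  apply: (IH j (fun t => g (cons_pair (x, t)))) => //.
  - by apply: (measurableT_comp mgc); exact: pair1_measurable.
  - move=> t ct; apply: g0 => h; apply: ct => k.
    by have := h (lift ord0 k); rewrite tnthS.
  - by move=> t; under eq_integral do rewrite -upd_cons; exact: gi.
rewrite -(integral21_prod_meas1 ig) /fubini_G.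
apply: integral0_eq => t _ /=.
by rewrite -[RHS](gi (cons_pair (0, t))); apply: eq_integral => s _; rewrite upd0_cons.
Qed.

End slices.

(** * The integral of a partial derivative vanishes *)

Section divergence.
Context {R : realType}.

Lemma continuous_vec_upd n (t : n.-tuple (measurableTypeR R)) (i : 'I_n) :
  continuous (fun s : R => vec_of_tuple (upd t i s)).
Proof.
move=> s; apply/cvgrPdist_lt => /= e e0; near=> z.
rewrite /Num.Def.normr /= mx_normrE; apply: bigmax_lt => //= -[j k] _ /=.
rewrite !mxE !tnth_mktuple; case: eqP => [_|_]; last by rewrite subrr normr0.
near: z; exact: cvgr_dist_lt.
Unshelve. all: by end_near. Qed.

Lemma vec_updD n (t : n.-tuple (measurableTypeR R)) (i : 'I_n) (s k : R) :
  vec_of_tuple (upd t i (k + s)) =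
  k *: delta_mx 0 i + vec_of_tuple (upd t i s).
Proof.
apply/rowP => j; rewrite !mxE !tnth_mktuple eqxx /=.
by case: eqP => [_|_]; rewrite ?mulr1 ?mulr0 ?add0r.
Qed.

Lemma is_derive_vec_upd n (G : 'rV[R]_n -> R) (i : 'I_n) (t : n.-tuple (measurableTypeR
  R)) (s l : R) :
  is_derive (vec_of_tuple (upd t i s)) (delta_mx 0 i) G l ->
  is_derive s 1 (fun s => G (vec_of_tuple (upd t i s))) l.
Proof.
have E : (fun h : R => h^-1 *: (((fun s => G (vec_of_tuple (upd t i s))) \o shift s) (h
  *: 1)
   - G (vec_of_tuple (upd t i s)))) =
  (fun h => h^-1 *: ((G \o shift (vec_of_tuple (upd t i s))) (h *: delta_mx 0 i)
      - G (vec_of_tuple (upd t i s)))).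
  by apply/funext => h; rewrite /= -vec_updD [_ *: 1]mulr1.
by move=> [h1 h2]; split; [move: h1; rewrite /derivable -E|move: h2; rewrite /derive -E].
Qed.

Definition in_cube (M : R) n : set 'rV[R]_n := [set x | forall i, `|x 0 i| <= M].

Lemma compact_in_cube M n : compact (@in_cube M n).
Proof.
have := @rV_compact R n (fun=> [set` `[(- M), M]]) (fun=> @segment_compact _ _ _).
congr compact; apply/seteqP; split => x /= h i; have := h i;
  by rewrite /= in_itv /= -ler_norml.
Qed.

Lemma continuous_cube_bounded n M (g : 'rV[R]_n -> R) : continuous g ->
  (forall x, ~ in_cube M x -> g x = 0) -> exists K, forall x, `|g x| <= K.
Proof.
move=> cg g0.
have /compact_bounded [K [_ hK]] : compact (g @` (@in_cube M n)).
  apply: continuous_compact; last exact: compact_in_cube.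
  exact: continuous_subspaceT.
exists (`|K| + 1) => x; have [h|h] := pselect (in_cube M x).
  apply: hK; last by exists x.
  by rewrite (le_lt_trans (ler_norm K))// ltrDl.
by rewrite g0// normr0 addr_ge0.
Qed.

Lemma integrable_continuous_cube n M (g : 'rV[R]_n -> R) : continuous g ->
  (forall x, ~ in_cube M x -> g x = 0) ->
  (@lebesgue_tuple R n).-integrable [set: _] (fun t => (g (vec_of_tuple t))%:E).
Proof.
move=> cg g0; have [K gK] := continuous_cube_bounded cg g0.
apply: (@integrable_bounded_support _ _ _ _ (cube M n) (g \o @vec_of_tuple R n) K) => //.
- exact: measurable_cube.
- exact: lebesgue_tuple_cube_lty.
- exact: measurable_continuous_tuple.
- by move=> x; exact: gK.
- move=> t ht; apply: g0 => h; apply: ht => i; have := h i; by rewrite mxE.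
Qed.

Lemma integral_derive_compact (h dh : R -> R) (M : R) : continuous dh ->
  (forall s : R, is_derive s 1 h (dh s)) ->
  (forall s, M < `|s| -> h s = 0 /\ dh s = 0) ->
  (\int[@lebesgue_measure R]_s (dh s)%:E = 0)%E.
Proof.
move=> cdh hdh h0.
pose a : R := `|M| + 1.
have Ma : M < `|a| by rewrite ger0_norm ?addr_ge0// (le_lt_trans (ler_norm M))// ltrDl.
have a0 : 0 < a by rewrite ltr_wpDl.
rewrite (_ : (\int[_]_s _)%E = (\int[lebesgue_measure]_(s in [set` (`[(- a), a])%R])
  (dh s)%:E)%E); last first.
  rewrite [RHS]integral_mkcond; apply: eq_integral => s _; rewrite patchE.
  case: ifPn => //; rewrite notin_setE /= in_itv /= -ler_norml => /negP.
  rewrite -ltNge => sa; have [] // := h0 s; last by move=> _ ->.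
  by rewrite (lt_trans _ sa)// -[ltRHS]ger0_norm ?ltW.
rewrite (@continuous_FTC2 _ dh h).
- have MNa : M < `|- a| by rewrite normrN.
  by rewrite (h0 _ Ma).1 (h0 _ MNa).1 subee.
- by rewrite gtrN.
- exact: continuous_subspaceT.
- have ch : continuous h.
    move=> s; apply/differentiable_continuous/derivable1_diffP.
    by have [] := hdh s.
  split.
  + by move=> s _; have [] := hdh s.
  + exact/cvg_at_right_filter/ch.
  + exact/cvg_at_left_filter/ch.
- by move=> s _; rewrite derive1E; have [] := hdh s.
Qed.

(** Along each line parallel to the [i]-th axis this is the fundamental theorem
of calculus for a function that vanishes outside a bounded interval. *)
Lemma integral_partial0 n (i : 'I_n) (G dG : 'rV[R]_n -> R) (M : R) :
  continuous dG ->
  (forall x, is_derive x (delta_mx 0 i) G (dG x)) ->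
  (forall x, ~ in_cube M x -> G x = 0 /\ dG x = 0) ->
  (\int[@lebesgue_tuple R n]_t (dG (vec_of_tuple t))%:E = 0)%E.
Proof.
move=> cdG hdG h0.
have h0' x : ~ in_cube M x -> dG x = 0 by move=> /h0[].
have [K gK] := continuous_cube_bounded cdG h0'.
apply: (@integral_slices0 _ _ i M K (dG \o @vec_of_tuple R n)).
- exact: measurable_continuous_tuple.
- by move=> t; exact: gK.
- move=> t ht; apply: h0' => h; apply: ht => j; have := h j; by rewrite mxE.
move=> t; apply: (@integral_derive_compact (fun s => G (vec_of_tuple (upd t i s))) _ M).
- by move=> s; apply: continuous_comp; [exact: continuous_vec_upd|exact: cdG].
- by move=> s; apply: is_derive_vec_upd; exact: hdG.
- move=> s Ms; apply: h0 => /(_ i); rewrite !mxE tnth_mktuple eqxx.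
  by rewrite leNgt Ms.
Qed.

End divergence.
Arguments in_cube {R} M n x : rename.

(** * Pointwise inequalities *)

Section scalar.
Context {R : realType}.
Implicit Types p q r x z y A a b c s : R.

Lemma le_powRl r x y : 0 <= r -> 0 <= x -> x <= y -> x `^ r <= y `^ r.
Proof.
by move=> r0 x0 xy; apply: ge0_ler_powR; rewrite ?nnegrE// (le_trans x0).
Qed.

(** Young's inequality for the product of [z] and [1], with exponents [q] and
[q / (q - 1)]. *)
Lemma bernoulli_powR q z : 1 <= q -> 0 <= z -> 1 + q * (z - 1) <= z `^ q.
Proof.
move=> q1 z0; have [->|qn1] := eqVneq q 1; first by rewrite powRr1//; lra.
have q1' : 1 < q by rewrite lt_neqAle eq_sym qn1.
have q0 : 0 < q by lra.
have := @conjugate_powR R z 1 q (q / (q - 1)) z0 ler01 q0.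
rewrite powR1 mulr1 => h.
have {}h : z <= z `^ q / q + 1 / (q / (q - 1)).
  apply: h; first by rewrite divr_gt0// subr_gt0.
  by field; apply/andP; split; lra.
 have -> : z `^ q = q * (z `^ q / q) by field; lra.
have -> : 1 + q * (z - 1) = q * (z - 1 / (q / (q - 1))).
  by field; apply/andP; split; lra.
by rewrite ler_pM2l// lerBlDr.
Qed.

(** After division by [A `^ p] and then by [z / A], this is Bernoulli's inequality
with exponent [p - 1]. The constant [p - 1] is the best possible, as [z = 0]
shows. *)
Lemma powR_quadratic p z A : 2 <= p -> 0 <= z -> 0 < A ->
  A `^ (p - 2) * (A ^+ 2 + p * A * (z - A) + (p - 1) * (z - A) ^+ 2) <= z `^ p.
Proof.
move=> p2 z0 A0.
have h : 1 + (p - 1) * (z / A - 1) <= (z / A) `^ (p - 1).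
  by apply: bernoulli_powR; [lra|rewrite divr_ge0// ltW].
rewrite -(@mulr_powRB1 _ z p)//; last lra.
have -> : z `^ (p - 1) = A `^ (p - 2) * A * (z / A) `^ (p - 1).
  rewrite [_ * A]mulrC (_ : p - 2 = (p - 1) - 1); last ring.
  rewrite mulr_powRB1 ?ltW//; last lra.
  rewrite -powRM; [|exact: ltW|by rewrite divr_ge0// ltW].
  by rewrite [A * _]mulrC divfK// gt_eqF.
have -> : A `^ (p - 2) * (A ^+ 2 + p * A * (z - A) + (p - 1) * (z - A) ^+ 2) =
  z * (A `^ (p - 2) * A * (1 + (p - 1) * (z / A - 1))) by field; lra.
by rewrite ler_wpM2l// ler_wpM2l// mulr_ge0 ?powR_ge0 ?ltW.
Qed.

(** The quadratic term of the previous bound is weakened by [sigma] and then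
replaced by its tangent at [z = A - b s], which makes the bound affine in [z]:
the slope is [p] times the flux of the vector field below. *)
Lemma powR_hardy_tangent p z A b s sigma : 2 <= p -> 0 <= z -> 0 < A ->
  sigma <= A `^ (p - 2) -> 0 <= sigma ->
  (p * A `^ (p - 2) * A - 2 * (p - 1) * b * sigma * s) * z
  - ((p - 1) * A `^ (p - 2) * A ^+ 2 - 2 * (p - 1) * b * sigma * s * A
     + (p - 1) * sigma * b ^+ 2 * s ^+ 2) <= z `^ p.
Proof.
move=> p2 z0 A0 sA s0; apply: le_trans (powR_quadratic p2 z0 A0).
set al := A `^ (p - 2) in sA *.
rewrite -subr_ge0.
have -> : al * (A ^+ 2 + p * A * (z - A) + (p - 1) * (z - A) ^+ 2) -
  ((p * al * A - 2 * (p - 1) * b * sigma * s) * z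
  - ((p - 1) * al * A ^+ 2 - 2 * (p - 1) * b * sigma * s * A
     + (p - 1) * sigma * b ^+ 2 * s ^+ 2)) =
  (p - 1) * ((al - sigma) * (z - A) ^+ 2 + sigma * (z - A + b * s) ^+ 2) by ring.
apply: mulr_ge0; first lra.
by apply: addr_ge0; apply: mulr_ge0; rewrite ?sqr_ge0// subr_ge0.
Qed.

(** The radial component [f(rho)] of the vector field, where [c = coth rho] and
[s = 1 / rho]. *)
Definition flux p a c s :=
  (a * c) `^ (p - 1) - 2 * ((p - 1) / p) ^+ 2 / a * (a * s) `^ (p - 1).

(** The derivative of the flux in [rho], as [c' = 1 - c ^+ 2] and
[s' = - s ^+ 2]. *)
Definition dflux p a c s :=
  (p - 1) * ((a * c) `^ (p - 2) * (a * (1 - c ^+ 2))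
   + 2 * ((p - 1) / p) ^+ 2 / a * (a * s) `^ (p - 2) * (a * s ^+ 2)).

Lemma flux_ge0 p a c s : 2 <= p -> p - 1 <= a -> 0 < s -> s <= c ->
  0 <= flux p a c s.
Proof.
move=> p2 pa s0 sc; rewrite /flux subr_ge0.
have a0 : 0 < a by lra.
have hh : 2 * ((p - 1) / p) ^+ 2 / a <= 1.
  rewrite ler_pdivrMr// mul1r; apply: le_trans pa.
  rewrite expr_div_n mulrA ler_pdivrMr ?exprn_gt0//; last lra.
  rewrite -subr_ge0.
  have -> : (p - 1) * p ^+ 2 - 2 * (p - 1) ^+ 2 = (p - 1) * ((p - 1) ^+ 2 + 1).
    by ring.
  by apply: mulr_ge0; [lra|rewrite addr_ge0// sqr_ge0].
apply: le_trans (_ : (a * s) `^ (p - 1) <= _).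
  by rewrite ler_piMl// powR_ge0.
by apply: le_powRl; rewrite ?ler_wpM2l ?mulr_ge0//; lra.
Qed.

(** The supersolution property of the flux, where [p * a = N - 1]. The tangent
inequality is used at [A = a c] with [sigma = (a s) `^ (p - 2)]; the terms in
[sigma s c] cancel, and [a >= p - 1], [c >= 1] bound the remaining
[(a c) `^ (p - 2) * ((a c) ^+ 2 - (p - 1) * a * (c ^+ 2 - 1))] from below by
[a `^ p]. *)
Lemma flux_pointwise p a c s z y : 2 <= p -> p - 1 <= a -> 0 < s -> s <= c ->
  1 <= c -> 0 <= z -> 0 <= y ->
  (a `^ p + (p - 1) * a `^ (p - 2) * ((p - 1) / p) ^+ 2 * s `^ p) * y `^ p
   <= z `^ p + (dflux p a c s + p * a * c * flux p a c s) * y `^ p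
      - p * flux p a c s * (y `^ (p - 1) * z).
Proof.
move=> p2 pa s0 sc c1 z0; rewrite le_eqVlt => /predU1P[<-|y0].
  by rewrite !powR0 ?mulr0 ?mul0r ?mulr0 ?subr0 ?addr0 ?powR_ge0//; lra.
have a0 : 0 < a by lra.
have c0 : 0 < c by lra.
have ac0 : 0 < a * c by rewrite mulr_gt0.
have as0 : 0 < a * s by rewrite mulr_gt0.
set b := (p - 1) / p.
set al := (a * c) `^ (p - 2).
set sg := (a * s) `^ (p - 2).
have sgal : sg <= al.
  by apply: le_powRl; [lra|exact: ltW|rewrite ler_wpM2l// ltW].
have acp1 : (a * c) `^ (p - 1) = al * (a * c).
  rewrite [RHS]mulrC /al (_ : p - 2 = (p - 1) - 1); last ring.
  by rewrite mulr_powRB1 ?ltW//; lra.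
have asp1 : (a * s) `^ (p - 1) = sg * (a * s).
  rewrite [RHS]mulrC /sg (_ : p - 2 = (p - 1) - 1); last ring.
  by rewrite mulr_powRB1 ?ltW//; lra.
have powp2 x : 0 <= x -> x `^ p = x `^ (p - 2) * x ^+ 2.
  move=> x0; rewrite -(@mulr_powRB1 _ x p)//; last lra.
  rewrite -(@mulr_powRB1 _ x (p - 1))//; last lra.
  by rewrite (_ : p - 1 - 1 = p - 2); ring.
have := powR_hardy_tangent b s p2 (divr_ge0 z0 (ltW y0)) ac0 sgal (powR_ge0 _ _).
rewrite -/al => h.
have {}h := ler_wpM2r (powR_ge0 y p) h.
have zy : (z / y) `^ p * y `^ p = z `^ p.
  rewrite -powRM; [|by rewrite divr_ge0// ltW|exact: ltW].
  by rewrite divfK// gt_eqF.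
rewrite zy in h.
have yp : y `^ p = y * y `^ (p - 1) by rewrite mulr_powRB1 ?ltW//; lra.
have eL : a `^ (p - 2) * s `^ p = sg * s ^+ 2.
  by rewrite (powp2 s (ltW s0)) mulrA -powRM; [|exact: ltW..].
have alge : a `^ (p - 2) <= al.
  by apply: le_powRl; [lra|exact: ltW|rewrite ler_peMr// ltW].
rewrite (powp2 a (ltW a0)).
apply: le_trans (_ : (al * a ^+ 2 + (p - 1) * b ^+ 2 * (sg * s ^+ 2)) * y `^ p <= _).
  rewrite ler_wpM2r ?powR_ge0// -eL.
  have -> : (p - 1) * a `^ (p - 2) * b ^+ 2 * s `^ p =
    (p - 1) * b ^+ 2 * (a `^ (p - 2) * s `^ p) by ring.
  by rewrite lerD2r ler_wpM2r// sqr_ge0.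
apply: le_trans (_ : (al * (a * c) ^+ 2 - (p - 1) * al * a * (c ^+ 2 - 1)
   + (p - 1) * b ^+ 2 * (sg * s ^+ 2)) * y `^ p <= _).
  rewrite ler_wpM2r ?powR_ge0// lerD2r -subr_ge0.
  have -> : al * (a * c) ^+ 2 - (p - 1) * al * a * (c ^+ 2 - 1) - al * a ^+ 2 =
    al * (a * ((a - (p - 1)) * (c ^+ 2 - 1))) by ring.
  apply: mulr_ge0; first exact: powR_ge0.
  apply: mulr_ge0; first exact: ltW.
  by rewrite mulr_ge0 ?subr_ge0// exprn_ege1.
rewrite -subr_ge0; rewrite -subr_ge0 in h; apply: le_trans h _.
rewrite le_eqVlt; apply/orP; left; apply/eqP.
rewrite /dflux /flux acp1 asp1 -/al -/sg -/b yp.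
have -> : b = (p - 1) / p by [].
by field; apply/andP; split; [lra|apply/andP; split; lra].
Qed.

End scalar.

(** * Rules for directional derivatives *)

Section derivative_rules.
Context {R : realType} {V : normedModType R}.
Implicit Types (f g : V -> R) (x v : V).

(** Reduces directional derivatives to derivatives of functions of one real
variable, for which the chain rule and the inverse rule are known. *)
Lemma is_derive_line f x v l :
  is_derive x v f l <-> is_derive (0 : R) 1 (fun k => f (k *: v + x)) l.
Proof.
have E : (fun h : R => h^-1 *: (((fun k => f (k *: v + x)) \o shift (0 : R)) (h *: 1)
   - f (0 *: v + x))) = (fun h => h^-1 *: ((f \o shift x) (h *: v) - f x)).
  by apply/funext => h; rewrite /= [_ *: 1]mulr1 addr0 scale0r add0r.
split=> -[h1 h2]; split.
- by rewrite /derivable E.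
- by rewrite /derive E.
- by move: h1; rewrite /derivable E.
- by move: h2; rewrite /derive E.
Qed.

Lemma is_derive_const (c : R) x v : is_derive x v (fun=> c) 0.
Proof. exact: is_derive_cst. Qed.

Lemma is_derive_add f g x v a b : is_derive x v f a -> is_derive x v g b ->
  is_derive x v (fun y => f y + g y) (a + b).
Proof. by move=> h1 h2; exact: (is_deriveD h1 h2). Qed.

Lemma is_derive_mul f g x v a b : is_derive x v f a -> is_derive x v g b ->
  is_derive x v (fun y => f y * g y) (a * g x + f x * b).
Proof.
move=> h1 h2; have := is_deriveM h1 h2.
by rewrite addrC [_ *: a]mulrC.
Qed.

Lemma is_derive_sqr f x v a : is_derive x v f a ->
  is_derive x v (fun y => f y ^+ 2) (2 * f x * a).
Proof. by move=> h; apply: (is_derive_eq (is_derive_mul h h)); ring. Qed.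

Lemma is_derive_sub f g x v a b : is_derive x v f a -> is_derive x v g b ->
  is_derive x v (fun y => f y - g y) (a - b).
Proof. by move=> h1 h2; exact: (is_deriveB h1 h2). Qed.

Lemma is_derive_comp (h : R -> R) g x v a b :
  is_derive (g x) 1 h a -> is_derive x v g b ->
  is_derive x v (fun y => h (g y)) (a * b).
Proof.
move=> hh /is_derive_line hg; apply/is_derive_line.
by apply: (is_derive1_comp (f := h)); rewrite ?scale0r ?add0r.
Qed.

Lemma is_derive_inv f x v a : f x != 0 -> is_derive x v f a ->
  is_derive x v (fun y => (f y)^-1) (- a / f x ^+ 2).
Proof.
move=> fx /is_derive_line hf; apply/is_derive_line.
have := @is_deriveV R (fun k => f (k *: v + x)) 0 _ 1 _ hf.
rewrite /= scale0r add0r => /(_ fx); rewrite [_ *: a]mulrC mulrN mulNr.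
by [].
Qed.

Lemma is_derive_near f g x v a : (\near x, f x = g x) ->
  is_derive x v g a -> is_derive x v f a.
Proof.
move=> fg [h1 h2]; have gf : \near x, g x = f x by near=> y; apply/esym; near: y.
split; last by rewrite -h2; apply: near_eq_derive.
by have := near_eq_derivable gf h1.
Unshelve. all: by end_near. Qed.

End derivative_rules.

(** * The inverse hyperbolic cosine *)

Section radial.
Context {R : realType}.
Implicit Types x a p : R.

(** [sinh] of the positive number whose [cosh] is [x]. *)
Definition sh x := Num.sqrt (x ^+ 2 - 1).
Definition arcosh x := ln (x + sh x).

Lemma sh_gt0 x : 1 < x -> 0 < sh x.
Proof. by move=> x1; rewrite sqrtr_gt0 subr_gt0 exprn_egt1. Qed.

Lemma sqr_sh x : 1 <= x -> sh x ^+ 2 = x ^+ 2 - 1.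
Proof. by move=> x1; rewrite sqr_sqrtr// subr_ge0 exprn_ege1. Qed.

Lemma is_derive_sh x : 1 < x -> is_derive x 1 sh (x / sh x).
Proof.
move=> x1.
have h : is_derive x 1 (fun x : R => x ^+ 2 - 1) (x *+ 2).
  have h := is_derive_sub (is_derive_sqr (is_derive_id x 1)) (is_derive_const 1 x 1).
  apply: (is_derive_eq h).
  by rewrite mulr1 subr0 mulr_natl.
have := is_derive_comp (is_derive1_sqrt _) h.
have s0 : 0 < x ^+ 2 - 1 by rewrite subr_gt0 exprn_egt1.
move=> /(_ s0) {}h; apply: (is_derive_eq h).
have := sh_gt0 x1; rewrite /sh => s1.
by rewrite -mulr_natr; field; rewrite gt_eqF.
Qed.

Lemma is_derive_arcosh x : 1 < x -> is_derive x 1 arcosh (sh x)^-1.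
Proof.
move=> x1; have s1 := sh_gt0 x1.
have h := is_derive_comp (is_derive1_ln _) (is_derive_add (is_derive_id x 1)
  (is_derive_sh x1)).
apply: (is_derive_eq (h _)); first by rewrite addr_gt0//; lra.
by field; apply/andP; split; lra.
Qed.

Lemma arcosh_gt0 x : 1 < x -> 0 < arcosh x.
Proof. by move=> x1; have s1 := sh_gt0 x1; rewrite ln_gt0//; lra. Qed.

Lemma arcosh1 : arcosh 1 = 0 :> R.
Proof. by rewrite /arcosh /sh expr1n subrr sqrtr0 addr0 ln1. Qed.

Lemma continuous_sh : continuous sh.
Proof.
move=> x; apply: (@continuous_comp _ _ _ (fun x : R => x ^+ 2 - 1) Num.sqrt).
  apply: cvgB; last exact: cvg_cst.
  exact: exprn_continuous.
exact: sqrt_continuous.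
Qed.

Lemma continuous_arcosh x : 1 <= x -> {for x, continuous arcosh}.
Proof.
move=> x1; apply: (@continuous_comp _ _ _ (fun x : R => x + sh x) (@ln R)).
  by apply: cvgD; [exact: cvg_id|exact: continuous_sh].
by apply: continuous_ln; rewrite ltr_pwDl ?sqrtr_ge0//; lra.
Qed.

(** This is [tanh rho <= rho] for [x = cosh rho]: the difference of the two sides
vanishes at [1] and has derivative [arcosh x]. *)
Lemma sh_le_arcosh x : 1 <= x -> sh x <= arcosh x * x.
Proof.
move=> x1; rewrite -subr_ge0.
pose h x := arcosh x * x - sh x.
have h1 : h 1 = 0 by rewrite /h arcosh1 mul0r /sh expr1n subrr sqrtr0 subr0.
rewrite -/(h x) -h1.
have dh (y : R) : y \in `]1, +oo[ -> is_derive y 1 h (arcosh y).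
  rewrite in_itv /= andbT => y1.
  have := is_derive_sub (is_derive_mul (is_derive_arcosh y1) (is_derive_id y 1))
    (is_derive_sh y1).
  by move=> h'; apply: (is_derive_eq h'); have := sh_gt0 y1 => s0; field; lra.
apply: (@ger0_derive1_ndecry _ h 1) => //.
- by move=> y /dh[].
- move=> y y1; rewrite derive1E; have [_ ->] := dh _ y1.
  by move: y1; rewrite in_itv /= andbT => y1; exact/ltW/arcosh_gt0.
- apply: continuous_in_subspaceT => y; rewrite inE /= in_itv /= andbT => y1.
  apply: cvgB; last exact: continuous_sh.
  by apply: cvgM; [exact: continuous_arcosh|exact: cvg_id].
Qed.

End radial.

(** * Cutoff functions *)

Section cutoff.
Context {R : realType}.
Implicit Types (t x a p : R) (m : nat).

Lemma is_derive_continuous (f : R -> R) x l : is_derive x 1 f l ->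
  {for x, continuous f}.
Proof. by move=> [h _]; exact/differentiable_continuous/derivable1_diffP. Qed.

Lemma is_derive0_sqr (f : R -> R) : (forall h, `|h| <= 1 -> `|f h| <= h ^+ 2) ->
  is_derive (0 : R) 1 f 0.
Proof.
move=> fh.
have f0 : f 0 = 0.
  by apply/eqP; rewrite -normr_le0 (le_trans (fh 0 _)) ?normr0 ?expr0n.
have cv : (fun h : R => h^-1 *: ((f \o shift 0) (h *: 1) - f 0)) @ 0^' --> (0 : R).
  apply/cvgrPdist_le => e e0; near=> h.
  have hn0 : h != 0 by near: h; exact: nbhs_dnbhs_neq.
  have h1 : `|h| <= Num.min 1 e.
    near: h; apply: dnbhs0_le; by rewrite lt_min ltr01.
  move: h1; rewrite le_min => /andP[h1 he].
  rewrite /= f0 subr0 addr0 [_ *: 1]mulr1 sub0r normrN normrM normfV.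
  rewrite ler_pdivrMl ?normr_gt0//; apply: le_trans (fh h h1) _.
  by rewrite -[h ^+ 2]real_normK ?num_real// expr2 ler_wpM2l.
by split; [apply/cvg_ex; exists 0|exact/cvg_lim].
Unshelve. all: by end_near. Qed.

Definition pos_part t := (t + `|t|) / 2.

Lemma pos_part_ge0 t : 0 <= t -> pos_part t = t.
Proof. by move=> t0; rewrite /pos_part ger0_norm//; field. Qed.

Lemma pos_part_le0 t : t <= 0 -> pos_part t = 0.
Proof. by move=> t0; rewrite /pos_part ler0_norm// subrr mul0r. Qed.

Lemma le_pos_part : {homo pos_part : t x / t <= x}.
Proof.
move=> t x tx; have [t0|/ltW t0] := leP 0 t.
  by rewrite !pos_part_ge0// (le_trans t0).
rewrite (pos_part_le0 t0); have [x0|/ltW x0] := leP 0 x.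
  by rewrite pos_part_ge0.
by rewrite pos_part_le0.
Qed.

Lemma pos_part0 t : 0 <= pos_part t.
Proof.
have [t0|/ltW t0] := leP 0 t; first by rewrite pos_part_ge0.
by rewrite pos_part_le0.
Qed.

Lemma continuous_pos_part : continuous pos_part.
Proof.
move=> t; apply: cvgM; last exact: cvg_cst.
by apply: cvgD; [exact: cvg_id|exact: norm_continuous].
Qed.

Lemma is_derive_pos_part_sqr t :
  is_derive t 1 (fun t => pos_part t ^+ 2) (2 * pos_part t).
Proof.
have [t0|t0|->] := ltgtP t 0.
- rewrite pos_part_le0 ?ltW// mulr0; apply: (is_derive_near _ (is_derive_const 0 t 1)).
  near=> x; rewrite pos_part_le0 ?expr0n//; near: x; exact: lt_le_nbhsl.
- rewrite pos_part_ge0 ?ltW//.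
  have h := is_derive_sqr (is_derive_id t (1 : R)).
  rewrite -[2 * t]mulr1; apply: (is_derive_near _ h).
  by near=> x; rewrite pos_part_ge0//; near: x; exact: lt_le_nbhsr.
rewrite pos_part_ge0// mulr0; apply: is_derive0_sqr => h h1.
have [h0|/ltW h0] := leP 0 h; first by rewrite pos_part_ge0// ger0_norm ?sqr_ge0.
by rewrite pos_part_le0// expr0n normr0 sqr_ge0.
Unshelve. all: by end_near. Qed.

(** A C^1 transition from 0, on the negative numbers, to 1 at infinity. *)
Definition step t := 1 - (1 + pos_part t ^+ 2)^-1.
Definition dstep t := 2 * pos_part t / (1 + pos_part t ^+ 2) ^+ 2.

Lemma step_den t : 1 <= 1 + pos_part t ^+ 2.
Proof. by rewrite lerDl sqr_ge0. Qed.

Lemma is_derive_step t : is_derive t 1 step (dstep t).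
Proof.
have d0 : 1 + pos_part t ^+ 2 != 0 by rewrite gt_eqF// (lt_le_trans _ (step_den t)).
have h := is_derive_sub (is_derive_const 1 t 1) (is_derive_inv (f :=
  fun t => 1 + pos_part t ^+ 2) d0
  (is_derive_add (is_derive_const 1 t 1) (is_derive_pos_part_sqr t))).
by apply: (is_derive_eq h); rewrite /dstep; field.
Qed.

Lemma step_ge0 t : 0 <= step t.
Proof. by rewrite subr_ge0 invf_le1 ?step_den// (lt_le_trans _ (step_den t)). Qed.

Lemma step_le1 t : step t <= 1.
Proof. by rewrite lerBlDr lerDl invr_ge0 (le_trans _ (step_den t)). Qed.

Lemma dstep_ge0 t : 0 <= dstep t.
Proof. by rewrite divr_ge0 ?sqr_ge0// mulr_ge0// pos_part0. Qed.

Lemma step_le0 t : t <= 0 -> step t = 0.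
Proof. by move=> t0; rewrite /step pos_part_le0// expr0n addr0 invr1 subrr. Qed.

Lemma dstep_le0 t : t <= 0 -> dstep t = 0.
Proof. by move=> t0; rewrite /dstep pos_part_le0// mulr0 mul0r. Qed.

Lemma le_step : {homo step : t x / t <= x}.
Proof.
move=> t x tx; rewrite /step lerD2l lerN2 lef_pV2 ?posrE; last 2 first.
- by rewrite (lt_le_trans _ (step_den _)).
- by rewrite (lt_le_trans _ (step_den _)).
by rewrite lerD2l lerXn2r ?nnegrE ?pos_part0// le_pos_part.
Qed.

Lemma step_lower t : 0 < 1 + t -> 1 - step t <= 2 / (1 + t).
Proof.
move=> t1; rewrite /step opprB addrC subrK -[leRHS]invrK lef_pV2 ?posrE; last 2 first.
- by rewrite (lt_le_trans _ (step_den _)).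
- by rewrite invr_gt0 divr_gt0.
rewrite invf_div ler_pdivrMr//; have [t0|/ltW t0] := leP 0 t.
  rewrite pos_part_ge0//; have := sqr_ge0 (t - 4^-1); rewrite !expr2; lra.
by rewrite pos_part_le0// expr0n /=; lra.
Qed.

Lemma continuous_dstep : continuous dstep.
Proof.
move=> t; have cp := continuous_pos_part (x := t).
have c1 : {for t, continuous (fun t => 1 + pos_part t ^+ 2)}.
  by apply: cvgD; [exact: cvg_cst|apply: cvgM].
apply: cvgM; first by apply: cvgM => //; exact: cvg_cst.
apply: cvgV; last by apply: cvgM.
by rewrite expf_neq0// gt_eqF// (lt_le_trans _ (step_den t)).
Qed.

(** Nondecreasing in [x], and also in [m] when [x >= 1]; it vanishes for
[x <= 1 + 1 / (m + 1)] and tends to [1] for every [x > 1]. *)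
Definition cutoff m x := step (m.+1%:R * (x - 1) - 1).
Definition dcutoff m x := dstep (m.+1%:R * (x - 1) - 1) * m.+1%:R.

Lemma is_derive_cutoff m x : is_derive x 1 (cutoff m) (dcutoff m x).
Proof.
have h := is_derive_sub (is_derive_mul (is_derive_const m.+1%:R x 1)
  (is_derive_sub (is_derive_id x (1 : R)) (is_derive_const 1 x 1)))
  (is_derive_const 1 x 1).
have := is_derive_comp (is_derive_step _) h.
by move=> h'; apply: (is_derive_eq h'); rewrite /dcutoff; ring.
Qed.

Lemma continuous_dcutoff m : continuous (dcutoff m).
Proof.
move=> x; apply: cvgM; last exact: cvg_cst.
apply: (@continuous_comp _ _ _ (fun x : R => m.+1%:R * (x - 1) - 1) dstep);
  last exact: continuous_dstep.
apply: cvgB; last exact: cvg_cst.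
apply: cvgM; first exact: cvg_cst.
by apply: cvgB; [exact: cvg_id|exact: cvg_cst].
Qed.

Lemma cutoff_arg_le0 m x : x <= 1 + m.+1%:R^-1 -> m.+1%:R * (x - 1) - 1 <= 0.
Proof.
by move=> xm; rewrite subr_le0 -ler_pdivlMl ?ltr0Sn// mulr1 lerBlDl.
Qed.

Lemma cutoff_ge0 m x : 0 <= cutoff m x. Proof. exact: step_ge0. Qed.
Lemma cutoff_le1 m x : cutoff m x <= 1. Proof. exact: step_le1. Qed.
Lemma dcutoff_ge0 m x : 0 <= dcutoff m x.
Proof. by rewrite mulr_ge0// dstep_ge0. Qed.

Lemma cutoff_eq0 m x : x <= 1 + m.+1%:R^-1 -> cutoff m x = 0.
Proof. by move=> /cutoff_arg_le0/step_le0. Qed.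

Lemma dcutoff_eq0 m x : x <= 1 + m.+1%:R^-1 -> dcutoff m x = 0.
Proof. by move=> /cutoff_arg_le0/dstep_le0; rewrite /dcutoff => ->; rewrite mul0r. Qed.

Lemma nondecreasing_cutoff x : 1 <= x -> nondecreasing_seq (cutoff ^~ x).
Proof.
move=> x1 m n mn; apply: le_step; rewrite lerB// ler_wpM2r ?subr_ge0//.
by rewrite ler_nat ltnS.
Qed.

Lemma cvg_cutoff x : 1 < x -> cutoff m x @[m --> \oo] --> (1 : R).
Proof.
move=> x1; have x10 : 0 < x - 1 by rewrite subr_gt0.
apply/cvgrPdist_le => e e0; near=> m.
rewrite ger0_norm ?subr_ge0 ?cutoff_le1//.
have h : 1 + (m.+1%:R * (x - 1) - 1) = m.+1%:R * (x - 1) by ring.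
have m1 : 0 < m.+1%:R :> R by rewrite ltr0Sn.
apply: le_trans (step_lower _) _; rewrite h; first by rewrite mulr_gt0.
have -> : 2 / (m.+1%:R * (x - 1)) = 2 / (x - 1) * m.+1%:R^-1.
  by field; apply/andP; split; rewrite gt_eqF.
rewrite -ler_pdivlMl ?divr_gt0//; apply: ltW; near: m.
have e1 : 0 < (2 / (x - 1))^-1 * e by rewrite mulr_gt0 ?invr_gt0 ?divr_gt0.
exact: near_infty_natSinv_lt (PosNum e1).
Unshelve. all: by end_near. Qed.

End cutoff.

(** * The radial vector field *)

Section profile.
Context {R : realType}.
Variables p a : R.
Hypotheses (p2 : 2 <= p) (pa : p - 1 <= a).
Implicit Types (x : R) (m : nat).

Let a0 : 0 < a. Proof. by move: p2 pa; lra. Qed.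

(** [coth rho] for [x = cosh rho]. *)
Definition cth x := x / sh x.
Definition radial_flux x := flux p a (cth x) (arcosh x)^-1.
Definition radial_dflux x := dflux p a (cth x) (arcosh x)^-1.

Lemma cth_ge1 x : 1 < x -> 1 <= cth x.
Proof.
move=> x1; have s0 := sh_gt0 x1; rewrite ler_pdivlMr// mul1r.
have h : sh x ^+ 2 <= x ^+ 2 by rewrite (sqr_sh (ltW x1)) lerBlDr lerDl.
by move: h; rewrite ler_sqr// nnegrE; lra.
Qed.

Lemma arcoshV_le_cth x : 1 < x -> (arcosh x)^-1 <= cth x.
Proof.
move=> x1; have s0 := sh_gt0 x1; rewrite ler_pdivlMr// ler_pdivrMl ?arcosh_gt0//.
exact/sh_le_arcosh/ltW.
Qed.

Lemma radial_flux_ge0 x : 1 < x -> 0 <= radial_flux x.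
Proof.
by move=> x1; apply: flux_ge0 => //; [rewrite invr_gt0 arcosh_gt0|exact: arcoshV_le_cth].
Qed.

Lemma is_derive_cth x : 1 < x -> is_derive x 1 cth ((1 - cth x ^+ 2) / sh x).
Proof.
move=> x1; have s0 := sh_gt0 x1; have sn0 : sh x != 0 by rewrite gt_eqF.
have h := is_derive_mul (is_derive_id x (1 : R)) (is_derive_inv sn0 (is_derive_sh x1)).
by apply: (is_derive_eq h); rewrite /cth; field.
Qed.

Lemma is_derive_arcoshV x : 1 < x ->
  is_derive x 1 (fun x => (arcosh x)^-1) (- (arcosh x)^-1 ^+ 2 / sh x).
Proof.
move=> x1; have s0 := sh_gt0 x1; have r0 := arcosh_gt0 x1.
have rn0 : arcosh x != 0 by rewrite gt_eqF.
have h := is_derive_inv rn0 (is_derive_arcosh x1).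
by apply: (is_derive_eq h); field; rewrite rn0 gt_eqF.
Qed.

Lemma is_derive_powRM (f : R -> R) q x l : 0 < f x -> is_derive x 1 f l ->
  is_derive x 1 (fun x => (a * f x) `^ q) (q * (a * f x) `^ (q - 1) * (a * l)).
Proof.
move=> f0 hf.
have h := is_derive_comp (is_derive1_powR q _) (is_derive_mul (is_derive_const a x 1) hf).
apply: (is_derive_eq (h _)); first by rewrite mulr_gt0.
by rewrite mul0r add0r.
Qed.

Lemma is_derive_radial_flux x : 1 < x ->
  is_derive x 1 radial_flux (radial_dflux x / sh x).
Proof.
move=> x1; have s0 := sh_gt0 x1; have r0 := arcosh_gt0 x1.
have c0 : 0 < cth x by rewrite (lt_le_trans _ (cth_ge1 x1)).
have rV0 : 0 < (arcosh x)^-1 by rewrite invr_gt0.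
have h := is_derive_sub (is_derive_powRM (p - 1) c0 (is_derive_cth x1))
  (is_derive_mul (is_derive_const (2 * ((p - 1) / p) ^+ 2 / a) x 1)
     (is_derive_powRM (f := fun x => (arcosh x)^-1) (p - 1) rV0 (is_derive_arcoshV x1))).
apply: (is_derive_eq h); rewrite /radial_dflux /dflux.
rewrite (_ : p - 1 - 1 = p - 2); last by ring.
by field; repeat (apply/andP; split); rewrite gt_eqF//; move: p2; lra.
Qed.

Lemma continuous_radial_dflux x : 1 < x -> {for x, continuous radial_dflux}.
Proof.
move=> x1; have s0 := sh_gt0 x1; have r0 := arcosh_gt0 x1.
have c0 : 0 < cth x by rewrite (lt_le_trans _ (cth_ge1 x1)).
have rV0 : 0 < (arcosh x)^-1 by rewrite invr_gt0.
have cc := is_derive_continuous (is_derive_cth x1).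
have cr := is_derive_continuous (is_derive_arcoshV x1).
have cpc := is_derive_continuous (is_derive_powRM (p - 2) c0 (is_derive_cth x1)).
have cpr := is_derive_continuous (is_derive_powRM (f :=
  fun x => (arcosh x)^-1) (p - 2) rV0 (is_derive_arcoshV x1)).
apply: cvgM; first exact: cvg_cst.
apply: cvgD.
  apply: cvgM => //; apply: cvgM; first exact: cvg_cst.
  by apply: cvgB; [exact: cvg_cst|apply: cvgM].
apply: cvgM; first by apply: cvgM => //; exact: cvg_cst.
by apply: cvgM; [exact: cvg_cst|apply: cvgM].
Qed.

(** As [grad (cosh rho) = sinh rho grad rho], the field [f(rho) grad rho] is
[profile (cosh rho) grad (cosh rho)]. *)
Definition profile x := radial_flux x / sh x.
Definition dprofile x := (radial_dflux x - cth x * radial_flux x) / sh x ^+ 2.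

Lemma is_derive_profile x : 1 < x -> is_derive x 1 profile (dprofile x).
Proof.
move=> x1; have s0 := sh_gt0 x1; have sn0 : sh x != 0 by rewrite gt_eqF.
have h := is_derive_mul (is_derive_radial_flux x1) (is_derive_inv sn0 (is_derive_sh x1)).
by apply: (is_derive_eq h); rewrite /dprofile /cth; field.
Qed.

Lemma continuous_dprofile x : 1 < x -> {for x, continuous dprofile}.
Proof.
move=> x1; have s0 := sh_gt0 x1; have cs := continuous_sh (x := x).
apply: cvgM; last first.
  by apply: cvgV; [rewrite gt_eqF// exprn_gt0|apply: cvgM].
apply: cvgB; first exact: continuous_radial_dflux.
apply: cvgM; first exact: is_derive_continuous (is_derive_cth x1).
exact: is_derive_continuous (is_derive_radial_flux x1).
Qed.

Definition weight m x := cutoff m x * profile x.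
Definition dweight m x := dcutoff m x * profile x + cutoff m x * dprofile x.

(* the singularities at [x = 1] disappear: everything vanishes near [x <= 1] *)
Let near_cutoff m x : x <= 1 -> \near x, x <= 1 + m.+1%:R^-1.
Proof.
by move=> x1; apply: lt_le_nbhsl; rewrite (le_lt_trans x1)// ltrDl invr_gt0.
Qed.

Lemma is_derive_weight m x : is_derive x 1 (weight m) (dweight m x).
Proof.
have [x1|x1] := ltP 1 x.
  exact: is_derive_mul (is_derive_cutoff m x) (is_derive_profile x1).
have x1' : x <= 1 + m.+1%:R^-1 by rewrite (le_trans x1)// lerDl.
rewrite /dweight cutoff_eq0// dcutoff_eq0// !mul0r addr0.
apply: (is_derive_near _ (is_derive_const 0 x 1)).
near=> y; rewrite /weight cutoff_eq0 ?mul0r//; near: y; exact: near_cutoff.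
Unshelve. all: by end_near. Qed.

Lemma continuous_dweight m : continuous (dweight m).
Proof.
move=> x; have [x1|x1] := ltP 1 x.
  apply: cvgD; apply: cvgM.
  - exact: continuous_dcutoff.
  - exact: is_derive_continuous (is_derive_profile x1).
  - exact: is_derive_continuous (is_derive_cutoff m x).
  - exact: continuous_dprofile.
have x1' : x <= 1 + m.+1%:R^-1 by rewrite (le_trans x1)// lerDl.
apply: (near_cst_continuous (0 : R)).
near=> y; rewrite /dweight cutoff_eq0 ?dcutoff_eq0 ?mul0r ?addr0//; near: y;
  exact: near_cutoff.
Unshelve. all: by end_near. Qed.

(** Here [y] and [z] stand for [|u|] and [|grad u|], and [g] for the product of
the sign of [u] and of the derivative of [u] along [grad (cosh rho)], whose norm
is [sh x]. The two terms on the right of [z `^ p] are the divergence of the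
product of [|u|^p] and of the cut off field. The derivative of the cutoff
contributes [sh x * dcutoff m x * f * y `^ p >= 0]. *)
Lemma weight_pointwise m x y z g : 1 <= x -> 0 <= y -> 0 <= z ->
  `|g| <= sh x * z ->
  cutoff m x * ((a `^ p + (p - 1) * a `^ (p - 2) * ((p - 1) / p) ^+ 2
     * (arcosh x)^-1 `^ p) * y `^ p) <=
  z `^ p + (((x ^+ 2 - 1) * dweight m x + (p * a + 1) * x * weight m x) * y `^ p
      + weight m x * (p * y `^ (p - 1) * g)).
Proof.
rewrite le_eqVlt => /predU1P[<-|x1] y0 z0 gz.
  have h : (1 : R) <= 1 + m.+1%:R^-1 by rewrite lerDl.
  by rewrite /dweight /weight cutoff_eq0// dcutoff_eq0// !(mul0r, mulr0, addr0) powR_ge0.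
have s0 := sh_gt0 x1; have r0 := arcosh_gt0 x1.
have rV0 : 0 < (arcosh x)^-1 by rewrite invr_gt0.
have f0 := radial_flux_ge0 x1.
have := flux_pointwise p2 pa rV0 (arcoshV_le_cth x1) (cth_ge1 x1) z0 y0.
rewrite -/(radial_flux x) -/(radial_dflux x) => h.
have {}h := ler_wpM2l (cutoff_ge0 m x) h; apply: le_trans h _.
have chz : cutoff m x * z `^ p <= z `^ p by rewrite ler_piMl ?powR_ge0// cutoff_le1.
have d0 : 0 <= sh x * dcutoff m x * radial_flux x * y `^ p.
  apply: mulr_ge0; last exact: powR_ge0.
  by apply: mulr_ge0 => //; apply: mulr_ge0; [exact: ltW|exact: dcutoff_ge0].
have g0 : 0 <= weight m x * (p * y `^ (p - 1) * (g + sh x * z)).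
  rewrite mulr_ge0//; first by rewrite /weight mulr_ge0 ?cutoff_ge0// /profile divr_ge0
    ?(ltW s0).
  rewrite mulr_ge0//; first by rewrite mulr_ge0 ?powR_ge0//; move: p2; lra.
  by move: gz; rewrite ler_norml => /andP[]; lra.
rewrite -subr_ge0.
have -> : x ^+ 2 - 1 = sh x ^+ 2 by rewrite (sqr_sh (ltW x1)).
have e : z `^ p + ((sh x ^+ 2 * dweight m x + (p * a + 1) * x * weight m x) * y `^ p
      + weight m x * (p * y `^ (p - 1) * g)) -
  cutoff m x * (z `^ p + (radial_dflux x + p * a * cth x * radial_flux x) * y `^ p
     - p * radial_flux x * (y `^ (p - 1) * z)) =
  (z `^ p - cutoff m x * z `^ p) + sh x * dcutoff m x * radial_flux x * y `^ p
   + weight m x * (p * y `^ (p - 1) * (g + sh x * z)).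
  by rewrite /dweight /weight /profile /dprofile /cth; field; rewrite gt_eqF.
by rewrite e; apply: addr_ge0 => //; apply: addr_ge0 => //; rewrite subr_ge0.
Qed.

End profile.

(** * Geometry of the Poincare ball *)

Section euclidean.
Context {R : realType} {n : nat}.
Implicit Types u v w x y : 'rV[R]_n.

Definition dot u v : R := \sum_i u 0 i * v 0 i.

Lemma dotC u v : dot u v = dot v u.
Proof. by apply: eq_bigr => i _; rewrite mulrC. Qed.

Lemma dotDl u v w : dot (u + v) w = dot u w + dot v w.
Proof. by rewrite -big_split; apply: eq_bigr => i _; rewrite mxE mulrDl. Qed.

Lemma dotZl (k : R) u w : dot (k *: u) w = k * dot u w.
Proof. by rewrite mulr_sumr; apply: eq_bigr => i _; rewrite mxE mulrA. Qed.

Lemma dotBl u v w : dot (u - v) w = dot u w - dot v w.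
Proof. by rewrite -scaleN1r dotDl dotZl mulN1r. Qed.

Lemma dotDr u v w : dot w (u + v) = dot w u + dot w v.
Proof. by rewrite dotC dotDl !(dotC w). Qed.

Lemma dotZr (k : R) u w : dot w (k *: u) = k * dot w u.
Proof. by rewrite dotC dotZl dotC. Qed.

Lemma dotBr u v w : dot w (u - v) = dot w u - dot w v.
Proof. by rewrite dotC dotBl !(dotC w). Qed.

Lemma sqnorm2E x : sqnorm2 x = dot x x.
Proof. by apply: eq_bigr => i _; rewrite expr2. Qed.

Lemma sqnorm2_ge0 x : 0 <= sqnorm2 x.
Proof. by apply: sumr_ge0 => i _; exact: sqr_ge0. Qed.

(** The square of the norm of [dot v v *: u - dot u v *: v] is [dot v v] times the
difference of the two sides. *)
Lemma cauchy_schwarz u v : dot u v ^+ 2 <= dot u u * dot v v.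
Proof.
have [v0|v0] := eqVneq (dot v v) 0.
  suff -> : dot u v = 0 by rewrite v0 mulr0 expr0n.
  apply: big1 => i _.
  have : v 0 i ^+ 2 == 0.
    by move/eqP: v0; rewrite -sqnorm2E psumr_eq0 => [/allP/(_ i)|j _];
      rewrite ?mem_index_enum ?sqr_ge0//; exact.
  by rewrite sqrf_eq0 => /eqP ->; rewrite mulr0.
have vp : 0 < dot v v by rewrite lt_neqAle eq_sym v0 -sqnorm2E sqnorm2_ge0.
have := sqnorm2_ge0 (dot v v *: u - dot u v *: v).
rewrite sqnorm2E dotBl !dotBr !dotZl !dotZr (dotC v u).
have -> : dot v v * (dot v v * dot u u) - dot v v * (dot u v * dot u v) -
  (dot u v * (dot v v * dot u v) - dot u v * (dot u v * dot v v)) =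
  dot v v * (dot u u * dot v v - dot u v ^+ 2) by ring.
by rewrite pmulr_rge0// subr_ge0.
Qed.

End euclidean.

Section euclidean_derivative.
Context {R : realType} {n : nat} {V : normedModType R}.
Implicit Types (X : V -> 'rV[R]_n) (t v : V) (d y : 'rV[R]_n).

Lemma is_derive_big (f : 'I_n -> V -> R) (df : 'I_n -> R) t v :
  (forall i, is_derive t v (f i) (df i)) ->
  is_derive t v (fun t => \sum_i f i t) (\sum_i df i).
Proof.
move=> h; have := is_derive_sum (h := f) h.
by congr is_derive; apply/funext => s; rewrite fct_sumE.
Qed.

Lemma is_derive_sqnorm2 X d t v : (forall i, is_derive t v (fun t => X t 0 i) (d 0 i)) ->
  is_derive t v (fun t => sqnorm2 (X t)) (2 * dot (X t) d).
Proof.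
move=> h; have h2 := is_derive_big (fun i => is_derive_sqr (h i)).
apply: (is_derive_eq h2); rewrite mulr_sumr.
by apply: eq_bigr => i _; rewrite mulrA.
Qed.

Lemma is_derive_sqnorm2B X d y t v : (forall i, is_derive t v (fun t => X t 0 i) (d 0 i)) ->
  is_derive t v (fun t => sqnorm2 (X t - y)) (2 * dot (X t - y) d).
Proof.
move=> h; apply: (is_derive_sqnorm2 (X := fun t => X t - y)) => i.
have h' := is_derive_sub (h i) (is_derive_const (y 0 i) t v).
have {}h' := is_derive_eq h' (subr0 _).
by rewrite (_ : (fun s => _) = (fun s => X s 0 i - y 0 i))//; apply/funext => s;
  rewrite !mxE.
Qed.

End euclidean_derivative.

Section poincare_ball.
Context {R : realType} {n : nat}.
Variable y : 'rV[R]_n.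
Hypothesis hy : hyp_space R n y.
Implicit Types x : 'rV[R]_n.

(** The conformal factor: the metric is the square of it times the Euclidean
one. *)
Definition conf x : R := 2 / (1 - sqnorm2 x).

(** The function [cosh rho], where [rho] is the distance to [y]. *)
Definition cosh_dist x : R :=
  1 + 2 * sqnorm2 (x - y) / ((1 - sqnorm2 x) * (1 - sqnorm2 y)).

(** The hyperbolic gradient of [cosh_dist]; [is_derive_cosh_dist] shows that it
is. *)
Definition pole_field x : 'rV[R]_n :=
  (1 - sqnorm2 y)^-1 *: ((1 - sqnorm2 x) *: (x - y) + sqnorm2 (x - y) *: x).

Let D0 : 1 - sqnorm2 y != 0. Proof. by rewrite gt_eqF// subr_gt0. Qed.

Lemma conf_gt0 x : hyp_space R n x -> 0 < conf x.
Proof. by move=> hx; rewrite divr_gt0// subr_gt0. Qed.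

Lemma cosh_dist_ge1 x : hyp_space R n x -> 1 <= cosh_dist x.
Proof.
move=> hx; rewrite lerDl divr_ge0//; first by rewrite mulr_ge0// sqnorm2_ge0.
by rewrite mulr_ge0// subr_ge0 ltW.
Qed.

Lemma sqnorm2B x z : sqnorm2 (x - z) = sqnorm2 x - 2 * dot x z + sqnorm2 z.
Proof. by rewrite !sqnorm2E !dotBl !dotBr (dotC z x); ring. Qed.

Lemma sqnorm_pole_field x : hyp_space R n x ->
  conf x ^+ 2 * dot (pole_field x) (pole_field x) = cosh_dist x ^+ 2 - 1.
Proof.
move=> hx; have B0 : 1 - sqnorm2 x != 0 by rewrite gt_eqF// subr_gt0.
rewrite /pole_field /conf /cosh_dist !dotZl !dotZr !dotDl !dotDr !dotZl !dotZr !dotBl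
  !dotBr.
rewrite sqnorm2B (dotC y x) -!sqnorm2E; field.
by rewrite D0 B0.
Qed.

(** The identity [div grad (cosh rho) = n cosh rho], divided by [n]: the two terms
come from the volume density [conf ^+ n] and from the Euclidean divergence of
[pole_field]. *)
Lemma cosh_dist_div x : hyp_space R n x ->
  conf x * dot (pole_field x) x + (sqnorm2 (x - y) + (1 - sqnorm2 x)) / (1 - sqnorm2 y)
  = cosh_dist x.
Proof.
move=> hx; have B0 : 1 - sqnorm2 x != 0 by rewrite gt_eqF// subr_gt0.
rewrite /pole_field /conf /cosh_dist !dotZl !dotDl !dotZl !dotBl.
rewrite sqnorm2B (dotC y x) -!sqnorm2E; field.
by rewrite D0 B0.
Qed.

Lemma dot_pole_field x d : dot (pole_field x) d = (1 - sqnorm2 y)^-1 *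
  ((1 - sqnorm2 x) * dot (x - y) d + sqnorm2 (x - y) * dot x d).
Proof. by rewrite [LHS]dotZl; congr (_ * _); rewrite [LHS]dotDl !dotZl. Qed.

Lemma dot_pole_field_le x (d : 'rV[R]_n) : hyp_space R n x ->
  `|dot (pole_field x) d| <= sh (cosh_dist x) * (Num.sqrt (dot d d) / conf x).
Proof.
move=> hx; have l0 := conf_gt0 hx.
have dd : 0 <= dot d d by rewrite -sqnorm2E sqnorm2_ge0.
rewrite mulrA ler_pdivlMr// -(@ler_pXn2r _ 2)// ?nnegrE; last 2 first.
- by rewrite mulr_ge0// ltW.
- by rewrite mulr_ge0// sqrtr_ge0.
rewrite exprMn [leRHS]exprMn real_normK ?num_real// (sqr_sh (cosh_dist_ge1 hx)) sqr_sqrtr//.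
rewrite -sqnorm_pole_field// [leLHS]mulrC -[leRHS]mulrA ler_pM2l ?exprn_gt0//.
exact: cauchy_schwarz.
Qed.

(* The derivatives are taken along an arbitrary map [X] into the ball, in order to
   serve both for the partial derivatives and for the velocity of curves. *)
Section along.
Context {V : normedModType R}.
Variables (X : V -> 'rV[R]_n) (t v : V) (d : 'rV[R]_n).
Hypothesis hX : forall i, is_derive t v (fun t => X t 0 i) (d 0 i).
Hypothesis hB : hyp_space R n (X t).

Let B0 : 1 - sqnorm2 (X t) != 0. Proof. by rewrite gt_eqF// subr_gt0. Qed.

Lemma is_derive_conf :
  is_derive t v (fun t => conf (X t)) (conf (X t) ^+ 2 * dot (X t) d).
Proof.
have h := is_derive_mul (is_derive_const 2 t v) (is_derive_inv (f :=
  fun t => 1 - sqnorm2 (X t)) B0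
  (is_derive_sub (is_derive_const 1 t v) (is_derive_sqnorm2 hX))).
by apply: (is_derive_eq h); rewrite /conf; field.
Qed.

Lemma is_derive_cosh_dist :
  is_derive t v (fun t => cosh_dist (X t)) (conf (X t) ^+ 2 * dot (pole_field (X t)) d).
Proof.
have h := is_derive_add (is_derive_const 1 t v)
  (is_derive_mul (is_derive_mul (is_derive_const 1 t v) (is_derive_sqnorm2B y hX))
   (is_derive_mul is_derive_conf (is_derive_const (1 - sqnorm2 y)^-1 t v))).
have E : (fun t => cosh_dist (X t)) =
  (fun t => 1 + 1 * sqnorm2 (X t - y) * (conf (X t) * (1 - sqnorm2 y)^-1)).
  by apply/funext => s; rewrite /cosh_dist /conf invfM; ring.
rewrite E; apply: (is_derive_eq h); rewrite dot_pole_field /conf.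
by field; rewrite D0 B0.
Qed.

Lemma is_derive_pole_field i :
  is_derive t v (fun t => pole_field (X t) 0 i)
    ((1 - sqnorm2 y)^-1 * ((- (2 * dot (X t) d)) * (X t 0 i - y 0 i)
      + (1 - sqnorm2 (X t)) * d 0 i + 2 * dot (X t - y) d * X t 0 i
      + sqnorm2 (X t - y) * d 0 i)).
Proof.
have h := is_derive_mul (is_derive_const (1 - sqnorm2 y)^-1 t v)
  (is_derive_add
    (is_derive_mul (is_derive_sub (is_derive_const 1 t v) (is_derive_sqnorm2 hX))
       (is_derive_sub (hX i) (is_derive_const (y 0 i) t v)))
    (is_derive_mul (is_derive_sqnorm2B y hX) (hX i))).
have E : (fun t => pole_field (X t) 0 i) = (fun t => (1 - sqnorm2 y)^-1 *
  ((1 - sqnorm2 (X t)) * (X t 0 i - y 0 i) + sqnorm2 (X t - y) * X t 0 i)).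
  by apply/funext => s; rewrite /pole_field !mxE.
by rewrite E; apply: (is_derive_eq h); field.
Qed.

End along.

End poincare_ball.

(** * The p-th power of the absolute value *)

Section power.
Context {R : realType}.
Variable p : R.
Hypothesis p2 : 2 <= p.
Implicit Types y : R.

Definition powabs y : R := `|y| `^ p.
Definition dpowabs y : R := p * `|y| `^ (p - 1) * Num.sg y.

Let p1 : 1 <= p - 1. Proof. by move: p2; lra. Qed.

Lemma is_derive_powabs y : is_derive y 1 powabs (dpowabs y).
Proof.
have [y0|y0|->] := ltgtP y 0.
- have h := is_derive_comp (is_derive1_powR p _) (is_derive_sub (is_derive_const 0 y 1)
  (is_derive_id y (1 : R))).
  have {}h := h ltac:(by rewrite sub0r oppr_gt0).
  apply: (@is_derive_near _ _ powabs (fun x => (0 - x) `^ p)).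
    near=> z; rewrite /powabs ler0_norm ?sub0r//; near: z; exact: lt_le_nbhsl.
  apply: (is_derive_eq h); rewrite /dpowabs ltr0_norm// ltr0_sg// !sub0r.
  by rewrite mulrN1.
- have h := is_derive1_powR p y0.
  apply: (@is_derive_near _ _ powabs (fun x => x `^ p)).
    near=> z; rewrite /powabs ger0_norm//; near: z; exact: lt_le_nbhsr.
  by apply: (is_derive_eq h); rewrite /dpowabs gtr0_norm// gtr0_sg// mulr1.
rewrite /dpowabs sgr0 mulr0; apply: is_derive0_sqr => h h1.
rewrite /powabs ger0_norm ?powR_ge0// -[h ^+ 2]real_normK ?num_real//.
have [->|h0] := eqVneq `|h| 0; first by rewrite powR0 ?expr0n//; move: p2; lra.
rewrite -powR_mulrn//; apply: ger_powR => //.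
by rewrite h1 andbT lt_neqAle eq_sym h0 normr_ge0.
Unshelve. all: by end_near. Qed.

Lemma continuous_powabs : continuous powabs.
Proof. by move=> y; exact: is_derive_continuous (is_derive_powabs y). Qed.

(** At [0] the bound [|dpowabs y| <= p |y|] for [|y| <= 1] is used. *)
Lemma continuous_dpowabs : continuous dpowabs.
Proof.
move=> y; have [->|y0] := eqVneq y 0.
  rewrite /continuous_at {2}/dpowabs sgr0 mulr0.
  apply/cvgrPdist_le => e e0.
  have H : \forall z \near (0 : R), `|z| <= Num.min 1 (e / p).
    by apply: nbhs0_le; rewrite lt_min ltr01 divr_gt0//; move: p2; lra.
  apply: (filterS _ H) => z.
  rewrite le_min => /andP[z1 ze]; rewrite sub0r normrN /dpowabs !normrM normr_sg.
  have pp : 0 < p by move: p2; lra.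
  apply: le_trans (_ : `|p| * `|z| <= _).
    rewrite -mulrA ler_wpM2l//; have [->|z0] := eqVneq z 0.
      by rewrite mulr0 normr0.
    rewrite mulr1 ger0_norm ?powR_ge0// -[leRHS]powRr1//.
    by apply: ger_powR => //; rewrite z1 andbT normr_gt0.
  by rewrite gtr0_norm// -ler_pdivlMl// mulrC.
have hc : {for y, continuous (fun y : R => `|y| `^ (p - 1))}.
  apply: (@continuous_comp _ _ _ (fun y : R => `|y|) (fun t => t `^ (p - 1))).
    exact: norm_continuous.
  by apply: is_derive_continuous (is_derive1_powR _ _); rewrite normr_gt0.
apply: cvgM; last first.
  apply: (near_cst_continuous (Num.sg y)); move: y0; rewrite neq_lt => /orP[y0|y0].
    by near=> z; rewrite !ltr0_sg//; near: z; exact: lt_nbhsl.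
  by near=> z; rewrite !gtr0_sg//; near: z; exact: lt_nbhsr.
apply: cvgM; first exact: cvg_cst.
exact: hc.
Unshelve. all: by end_near. Qed.

End power.

Section exprn.
Context {R : realType} {V : normedModType R}.

Lemma is_derive_exprn (f : V -> R) (x v : V) (df : R) k : f x != 0 -> is_derive x v f df ->
  is_derive x v (fun y => f y ^+ k) (k%:R * f x ^+ k * (df / f x)).
Proof.
move=> f0 hf; elim: k => [|k IH].
  by rewrite !mul0r; exact: is_derive_const.
have h := is_derive_mul hf IH.
have E : (fun y => f y ^+ k.+1) = (fun y => f y * f y ^+ k) by apply/funext => y;
  rewrite exprS.
rewrite E; apply: (is_derive_eq h); rewrite exprS -natr1; field; exact: f0.
Qed.

End exprn.

(** * Continuity rules and test functions *)

Section continuity_rules.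
Context {R : realType} {T : topologicalType}.
Implicit Types (f g : T -> R) (x : T).

Lemma continuous_const (c : R) x : {for x, continuous (fun _ : T => c)}.
Proof. exact: cvg_cst. Qed.

Lemma continuous_add f g x : {for x, continuous f} -> {for x, continuous g} ->
  {for x, continuous (fun y => f y + g y)}.
Proof. exact: cvgD. Qed.

Lemma continuous_sub f g x : {for x, continuous f} -> {for x, continuous g} ->
  {for x, continuous (fun y => f y - g y)}.
Proof. exact: cvgB. Qed.

Lemma continuous_mul f g x : {for x, continuous f} -> {for x, continuous g} ->
  {for x, continuous (fun y => f y * g y)}.
Proof. exact: cvgM. Qed.

Lemma continuous_inv f x : f x != 0 -> {for x, continuous f} ->
  {for x, continuous (fun y => (f y)^-1)}.
Proof. by move=> f0; apply: cvgV. Qed.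

Lemma continuous_expn f k x : {for x, continuous f} ->
  {for x, continuous (fun y => f y ^+ k)}.
Proof.
move=> cf; elim: k => [|k IH].
  have -> : (fun y => f y ^+ 0) = (fun=> 1) by [].
  exact: continuous_const.
have -> : (fun y => f y ^+ k.+1) = (fun y => f y * f y ^+ k) by apply/funext => y;
  rewrite exprS.
exact: continuous_mul.
Qed.

Lemma continuous_sumR (I : Type) (r : seq I) (F : I -> T -> R) x :
  (forall i, {for x, continuous (F i)}) ->
  {for x, continuous (fun y => \sum_(i <- r) F i y)}.
Proof.
move=> cF; elim: r => [|i r IH].
  have -> : (fun y => \sum_(i <- [::]) F i y) = (fun=> 0) by apply/funext => y;
    rewrite big_nil.
  exact: continuous_const.
have -> : (fun y => \sum_(i0 <- i :: r) F i0 y) = (fun y => F i y + \sum_(j <- r) F j y).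
  by apply/funext => y; rewrite big_cons.
exact: continuous_add.
Qed.

End continuity_rules.

Section ball_continuity.
Context {R : realType} {n : nat}.
Implicit Types x : 'rV[R]_n.

Lemma continuous_coord i x : {for x, continuous (fun x : 'rV[R]_n => x 0 i)}.
Proof. exact: coord_continuous. Qed.

Lemma continuous_sqnorm2 x : {for x, continuous (@sqnorm2 R n)}.
Proof.
by apply: continuous_sumR => i; apply: continuous_expn; exact: continuous_coord.
Qed.

Lemma continuous_sqnorm2B (y x : 'rV[R]_n) : {for x, continuous (fun x => sqnorm2 (x - y))}.
Proof.
have -> : (fun x => sqnorm2 (x - y)) = (fun x => \sum_i (x 0 i - y 0 i) ^+ 2).
  by apply/funext => s; apply: eq_bigr => i _; rewrite !mxE.
apply: continuous_sumR => i; apply: continuous_expn.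
by apply: continuous_sub; [exact: continuous_coord|exact: continuous_const].
Qed.

Lemma continuous_conf x : hyp_space R n x -> {for x, continuous (@conf R n)}.
Proof.
move=> hx; apply: continuous_mul; first exact: continuous_const.
apply: continuous_inv; first by rewrite gt_eqF// subr_gt0.
by apply: continuous_sub; [exact: continuous_const|exact: continuous_sqnorm2].
Qed.

Lemma continuous_cosh_dist (y x : 'rV[R]_n) : hyp_space R n x ->
  {for x, continuous (cosh_dist y)}.
Proof.
move=> hx.
have -> : cosh_dist y = (fun x => 1 + sqnorm2 (x - y) * (conf x * (1 - sqnorm2 y)^-1)).
  by apply/funext => s; rewrite /cosh_dist /conf invfM; ring.
apply: continuous_add; first exact: continuous_const.
apply: continuous_mul; first exact: continuous_sqnorm2B.
by apply: continuous_mul; [exact: continuous_conf|exact: continuous_const].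
Qed.

Lemma continuous_pole_field (y x : 'rV[R]_n) i :
  {for x, continuous (fun x => pole_field y x 0 i)}.
Proof.
have -> : (fun t => pole_field y t 0 i) = (fun t => (1 - sqnorm2 y)^-1 *
  ((1 - sqnorm2 t) * (t 0 i - y 0 i) + sqnorm2 (t - y) * t 0 i)).
  by apply/funext => s; rewrite /pole_field !mxE.
have ci := @continuous_coord i x.
have cc := fun c => @continuous_const R _ c x.
apply: (continuous_mul (cc _)); apply: continuous_add; apply: continuous_mul => //.
- by apply: (continuous_sub (cc _)); exact: continuous_sqnorm2.
- exact: (continuous_sub ci (cc _)).
- exact: continuous_sqnorm2B.
Qed.

(** Extension by zero: [F] need only be continuous on the ball as the support of
[v] is closed and contained in the ball. *)
Lemma continuous_mul_support (K : set 'rV[R]_n) (F v : 'rV[R]_n -> R) :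
  closed K -> K `<=` hyp_space R n ->
  (forall x, hyp_space R n x -> {for x, continuous F}) ->
  continuous v -> (forall x, ~ K x -> v x = 0) ->
  continuous (fun x => F x * v x).
Proof.
move=> cK KU cF cv v0 x; have [hx|hx] := pselect (hyp_space R n x).
  by apply: continuous_mul; [exact: cF|exact: cv].
apply: (near_cst_continuous (0 : R)).
have : nbhs x (~` K).
  by apply: open_nbhs_nbhs; split; [exact: closed_openC|move=> /KU].
by apply: filterS => z /v0 ->; rewrite mulr0.
Qed.

End ball_continuity.

Section test.
Context {R : realType} {n : nat}.
Variables (u : 'rV[R]_n -> R).
Hypothesis hu : test_function (hyp_space R n) u.
Implicit Types x : 'rV[R]_n.

Definition supp : set 'rV[R]_n := closure [set x | u x != 0].

Lemma closed_supp : closed supp. Proof. exact: closed_closure. Qed.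

Lemma supp_ball : supp `<=` hyp_space R n. Proof. by case: hu. Qed.

Lemma supp0 x : ~ supp x -> u x = 0.
Proof.
move=> nx; have [//|ux] := eqVneq (u x) 0.
by exfalso; apply: nx; exact: subset_closure.
Qed.

Lemma near_supp0 x : ~ supp x -> \near x, ~ supp x.
Proof.
move=> nx; have : nbhs x (~` supp); last by [].
by apply: open_nbhs_nbhs; split => //; exact/closed_openC/closed_supp.
Qed.

Lemma continuous_test : continuous u.
Proof. by case: hu => /(_ [::])[]. Qed.

Lemma continuous_partial i : continuous (partial i u).
Proof. by case: hu => /(_ [:: i])[]. Qed.

Lemma is_derive_test i x : is_derive x (delta_mx 0 i) u (partial i u x).
Proof. by case: hu => /(_ [::])[_ h] _ _; apply: derivableP; exact: h. Qed.

Lemma supp_cube x : ~ in_cube 1 n x -> ~ supp x.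
Proof.
move=> nc /supp_ball hx; apply: nc => i.
rewrite -(@ler_pXn2r _ 2)// ?nnegrE// real_normK ?num_real// expr1n.
apply: le_trans (ltW hx); rewrite /sqnorm2 (bigD1 i)//= lerDl.
by apply: sumr_ge0 => j _; exact: sqr_ge0.
Qed.

End test.

(** * Divergence of the field against a test function *)

Section divergence_field.
Context {R : realType} {n : nat}.
Variables (y : 'rV[R]_n) (W dW : R -> R).
Hypothesis hy : hyp_space R n y.
Hypothesis hW : forall x : R, is_derive x 1 W (dW x).
Hypothesis cdW : continuous dW.
Implicit Types x : 'rV[R]_n.

Let cW : continuous W.
Proof. by move=> x; exact: is_derive_continuous (hW x). Qed.

(** The Euclidean divergence of the product of a field and of the volume density
is the product of its Riemannian divergence and of the density, whence the
factor [conf x ^+ n]. *)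
Definition vfield i x := conf x ^+ n * W (cosh_dist y x) * pole_field y x 0 i.

Definition dvfield i x := conf x ^+ n *
  (n%:R * (conf x * x 0 i) * W (cosh_dist y x) * pole_field y x 0 i
   + dW (cosh_dist y x) * (conf x ^+ 2 * pole_field y x 0 i) * pole_field y x 0 i
   + W (cosh_dist y x) * ((sqnorm2 (x - y) + (1 - sqnorm2 x)) / (1 - sqnorm2 y))).

Lemma dot_delta_mx x i : dot x (delta_mx 0 i) = x 0 i.
Proof.
rewrite /dot (bigD1 i)//= mxE !eqxx mulr1 big1 ?addr0// => j ji.
by rewrite mxE (negbTE ji) andbF mulr0.
Qed.

Lemma is_derive_coord x (i j : 'I_n) :
  is_derive x (delta_mx 0 i) (fun x => x 0 j) ((delta_mx 0 i : 'rV[R]_n) 0 j).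
Proof.
apply/is_derive_line.
have h := is_derive_add (is_derive_mul (is_derive_id (0 : R) (1 : R))
   (is_derive_const ((delta_mx 0 i : 'rV[R]_n) 0 j) (0 : R) 1)) (is_derive_const (x 0
     j) (0 : R) 1).
have -> : (fun k : R => (k *: delta_mx 0 i + x) 0 j) =
  (fun k => k * (delta_mx 0 i : 'rV[R]_n) 0 j + x 0 j).
  by apply/funext => k; rewrite !mxE.
by apply: (is_derive_eq h); rewrite mulr0 !addr0 mul1r.
Qed.

Lemma is_derive_vfield i x : hyp_space R n x ->
  is_derive x (delta_mx 0 i) (vfield i) (dvfield i x).
Proof.
move=> hx; have hc := is_derive_coord x i.
have l0 : conf x != 0 by rewrite gt_eqF// conf_gt0.
have B0 : 1 - sqnorm2 x != 0 by rewrite gt_eqF// subr_gt0.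
have D0 : 1 - sqnorm2 y != 0 by rewrite gt_eqF// subr_gt0.
have h := is_derive_mul (is_derive_mul (is_derive_exprn n l0 (is_derive_conf (X :=
  id) hc hx))
  (is_derive_comp (hW _) (is_derive_cosh_dist hy (X :=
    id) hc hx))) (is_derive_pole_field hy (X := id) hc i).
apply: (is_derive_eq h); rewrite /dvfield !dot_delta_mx !mxE !eqxx /=.
by field; rewrite D0 l0.
Qed.

(** [div (W(P) grad P) = W'(P) |grad P|^2 + W(P) div (grad P)] for
[P = cosh rho], with [|grad P|^2 = P^2 - 1] and [div grad P = n P]. *)
Lemma sum_dvfield x : hyp_space R n x ->
  \sum_i dvfield i x = conf x ^+ n *
   ((cosh_dist y x ^+ 2 - 1) * dW (cosh_dist y x) + n%:R * cosh_dist y x * W (cosh_dist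
     y x)).
Proof.
move=> hx; rewrite -mulr_sumr; congr (_ * _).
rewrite !big_split /= sumr_const card_ord -(sqnorm_pole_field hy hx) -[in n%:R *
  _](cosh_dist_div hy hx).
have -> : \sum_(i < n) n%:R * (conf x * x 0 i) * W (cosh_dist y x) * pole_field y x 0 i =
   n%:R * conf x * W (cosh_dist y x) * dot (pole_field y x) x.
  by rewrite mulr_sumr; apply: eq_bigr => i _; ring.
have -> : \sum_(i < n) dW (cosh_dist y x) * (conf x ^+ 2 * pole_field y x 0 i) *
  pole_field y x 0 i =
   dW (cosh_dist y x) * conf x ^+ 2 * dot (pole_field y x) (pole_field y x).
  by rewrite mulr_sumr; apply: eq_bigr => i _; ring.
by rewrite -mulr_natl; ring.
Qed.

Lemma continuous_vfield i x : hyp_space R n x -> {for x, continuous (vfield i)}.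
Proof.
move=> hx; apply: continuous_mul; last exact: continuous_pole_field.
apply: continuous_mul; first by apply: continuous_expn; exact: continuous_conf.
by apply: continuous_comp; [exact: continuous_cosh_dist|exact: cW].
Qed.

Lemma continuous_dvfield i x : hyp_space R n x -> {for x, continuous (dvfield i)}.
Proof.
move=> hx; have ci := @continuous_coord R n i x; have cf := continuous_conf hx.
have cP := continuous_cosh_dist (y := y) hx; have cY := @continuous_pole_field R n y x i.
have cWP : {for x, continuous (fun x => W (cosh_dist y x))}.
  by apply: continuous_comp; [exact: cP|exact: cW].
have cdWP : {for x, continuous (fun x => dW (cosh_dist y x))}.
  by apply: continuous_comp; [exact: cP|exact: cdW].
have cc := fun c => @continuous_const R _ c x.
apply: continuous_mul; first exact: continuous_expn.
apply: continuous_add; first apply: continuous_add.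
- apply: continuous_mul => //; apply: continuous_mul => //.
  by apply: continuous_mul; [exact: cc|exact: continuous_mul].
- apply: continuous_mul => //; apply: continuous_mul => //.
  by apply: continuous_mul => //; exact: continuous_expn.
apply: continuous_mul => //; apply: continuous_mul; last exact: cc.
apply: continuous_add; first exact: continuous_sqnorm2B.
by apply: continuous_sub; [exact: cc|exact: continuous_sqnorm2].
Qed.

Variables (p : R) (u : 'rV[R]_n -> R).
Hypothesis p2 : 2 <= p.
Hypothesis hu : test_function (hyp_space R n) u.

Let G i x := vfield i x * powabs p (u x).
Let dG i x := dvfield i x * powabs p (u x) + vfield i x * (dpowabs p (u x) * partial i u x).

Let powabs0 x : ~ supp u x -> powabs p (u x) = 0.
Proof. by move=> /supp0 ->; rewrite /powabs normr0 powR0//; move: p2; lra. Qed.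

Let dpowabs0 i x : ~ supp u x -> dpowabs p (u x) * partial i u x = 0.
Proof. by move=> /supp0 ->; rewrite /dpowabs sgr0 mulr0 mul0r. Qed.

Let is_derive_G i x : is_derive x (delta_mx 0 i) (G i) (dG i x).
Proof.
have [hx|hx] := pselect (hyp_space R n x).
  exact: is_derive_mul (is_derive_vfield i hx)
    (is_derive_comp (is_derive_powabs p2 _) (is_derive_test hu i x)).
have ns : ~ supp u x by move=> /(supp_ball hu).
rewrite /dG powabs0// dpowabs0// !mulr0 addr0.
apply: (is_derive_near _ (is_derive_const 0 x _)).
near=> z; rewrite /G powabs0 ?mulr0//; near: z; exact: near_supp0.
Unshelve. all: by end_near. Qed.

Let continuous_dG i : continuous (dG i).
Proof.
have cu := continuous_test hu.
have h1 : continuous (fun x => dvfield i x * powabs p (u x)).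
  apply: (continuous_mul_support (@closed_supp _ _ u) (supp_ball hu)
    (@continuous_dvfield i)).
    by move=> z; apply: continuous_comp; [exact: cu|exact: continuous_powabs].
  exact: powabs0.
have h2 : continuous (fun x => vfield i x * (dpowabs p (u x) * partial i u x)).
  apply: (continuous_mul_support (@closed_supp _ _ u) (supp_ball hu)
    (@continuous_vfield i)).
    have hc : forall z, {for z, continuous (fun x => dpowabs p (u x))}.
      by move=> z; apply: continuous_comp; [exact: cu|exact: continuous_dpowabs].
    have hp : forall z, {for z, continuous (partial i u)} by exact: continuous_partial.
    move=> z; have hz := continuous_mul (hc z) (hp z). exact: hz.
  exact: dpowabs0.
by move=> x; exact: (continuous_add (h1 x) (h2 x)).
Qed.

Let zero_dG i x : ~ in_cube 1 n x -> dG i x = 0.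
Proof.
by move=> /(supp_cube hu) ns; rewrite /dG powabs0// dpowabs0// !mulr0 addr0.
Qed.

(** The divergence of the product of [|u|^p] and of the field
[W(P) grad P], multiplied by the volume density. *)
Definition div_test x := conf x ^+ n *
  (((cosh_dist y x ^+ 2 - 1) * dW (cosh_dist y x)
     + n%:R * cosh_dist y x * W (cosh_dist y x)) * powabs p (u x)
   + W (cosh_dist y x) * (dpowabs p (u x) * dot (pole_field y x) (\row_i partial i u x))).

Let sum_dG x : \sum_i dG i x = div_test x.
Proof.
have [hx|hx] := pselect (hyp_space R n x); last first.
  have ns : ~ supp u x by move=> /(supp_ball hu).
  rewrite /div_test powabs0// (supp0 ns) /dpowabs sgr0 !(mulr0, mul0r, addr0).
  by apply: big1 => i _; rewrite /dG powabs0// dpowabs0// !mulr0 addr0.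
rewrite big_split /= -mulr_suml sum_dvfield// /div_test [RHS]mulrDr; congr (_ + _);
  first by rewrite mulrA.
by rewrite /dot !mulr_sumr; apply: eq_bigr => i _; rewrite mxE /vfield; ring.
Qed.

Lemma continuous_div_test : continuous div_test.
Proof.
have -> : div_test = (fun x => \sum_i dG i x) by apply/funext => x; rewrite sum_dG.
by move=> x; apply: continuous_sumR => i; exact: continuous_dG.
Qed.

Lemma div_test0 x : ~ in_cube 1 n x -> div_test x = 0.
Proof. by move=> h; rewrite -sum_dG big1// => i _; exact: zero_dG. Qed.

Lemma integral_div_test :
  (\int[@lebesgue_tuple R n]_t (div_test (vec_of_tuple t))%:E = 0)%E.
Proof.
under eq_integral do rewrite -sum_dG -sumEFin.
rewrite integral_sum//; last first.
  move=> i; apply: (@integrable_continuous_cube _ _ 1 (dG i)); first exact: continuous_dG.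
  exact: zero_dG.
apply: big1 => i _; apply: (@integral_partial0 _ _ i (G i) (dG i) 1).
- exact: continuous_dG.
- exact: is_derive_G.
- move=> x nc; split; last exact: zero_dG.
  by rewrite /G powabs0 ?mulr0//; exact: supp_cube nc.
Qed.

End divergence_field.

(** * Lower bound for the geodesic distance *)

Section distance.
Context {R : realType} {n : nat}.
Implicit Types x y d : 'rV[R]_n.

Lemma hyp_norm_sqrt x d : hyp_norm x d = Num.sqrt (conf x ^+ 2 * dot d d).
Proof.
rewrite /hyp_norm /riem_norm /riem_inner /hyp_metric mul_mx_scalar -scalemxAl mxE.
congr (Num.sqrt (_ * _)).
by rewrite mxE; apply: eq_bigr => i _; rewrite mxE.
Qed.

Lemma hyp_normE x d : hyp_space R n x -> hyp_norm x d = conf x * Num.sqrt (dot d d).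
Proof.
by move=> /conf_gt0 l0; rewrite hyp_norm_sqrt sqrtrM ?sqr_ge0// sqrtr_sqr gtr0_norm.
Qed.

Lemma sh_le (a b : R) : 1 <= a -> a <= b -> sh a <= sh b.
Proof.
move=> a1 ab; have b1 := le_trans a1 ab.
by apply: ler_wsqrtr; rewrite lerB// lerXn2r ?nnegrE//; lra.
Qed.

Lemma arcosh_le (a b : R) : 1 <= a -> a <= b -> arcosh a <= arcosh b.
Proof.
move=> a1 ab; have b1 := le_trans a1 ab.
have sab := sh_le a1 ab.
rewrite ler_ln ?posrE ?lerD//.
- by rewrite ltr_pwDl ?sqrtr_ge0//; lra.
- by rewrite ltr_pwDl ?sqrtr_ge0//; lra.
Qed.

Lemma cosh_dist_pole y : cosh_dist y y = 1.
Proof.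
rewrite /cosh_dist subrr /sqnorm2 big1 ?mulr0 ?mul0r ?addr0// => i _.
by rewrite mxE expr0n.
Qed.

Lemma continuous_dot_comp (T : topologicalType) (X Y : T -> 'rV[R]_n) (t : T) :
  (forall i, {for t, continuous (fun t => X t 0 i)}) ->
  (forall i, {for t, continuous (fun t => Y t 0 i)}) ->
  {for t, continuous (fun t => dot (X t) (Y t))}.
Proof. by move=> cX cY; apply: continuous_sumR => i; exact: continuous_mul. Qed.

(** The function [arcosh] of [cosh_dist] is not differentiable at the pole, but
[arcosh] of [cosh_dist + e] is; its derivative along the curve is at most the
speed because [sh] is increasing. Then [e] tends to [0]. *)
Lemma arcosh_cosh_dist_le_length x y (c : R -> 'rV[R]_n) :
  hyp_space R n y -> C1_curve (hyp_space R n) x y c ->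
  arcosh (cosh_dist y x) <= riem_length hyp_metric c.
Proof.
move=> hy [dc cc' Uc c0 c1].
have hc (t : R) i : is_derive t 1 (fun t => c t 0 i) (derive1 c t 0 i).
  have dt := dc t; apply: DeriveDef; first by move/derivable_mxP : dt.
  by rewrite derive1E derive_mx// mxE.
have cc (t : R) : {for t, continuous c}.
  exact/differentiable_continuous/derivable1_diffP.
have cci (t : R) i : {for t, continuous (fun t => c t 0 i)}.
  exact: is_derive_continuous (hc t i).
have cc'i (t : R) i : {for t, continuous (fun t => derive1 c t 0 i)}.
  by apply: (@continuous_comp _ _ _ (derive1 c) (fun v : 'rV[R]_n => v 0 i));
    [exact: cc'|exact: continuous_coord].
pose L t := riem_norm hyp_metric (c t) (derive1 c t).
have LE (t : R) : 0 <= t <= 1 -> L t = conf (c t) * Num.sqrt (dot (derive1 c t)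
  (derive1 c t)).
  by move=> t01; rewrite /L -hyp_normE//; exact: Uc.
have cdot (t : R) : {for t, continuous (fun t => dot (derive1 c t) (derive1 c t))}.
  by apply: continuous_dot_comp => i.
have cconf (t : R) : 0 <= t <= 1 -> {for t, continuous (fun t => conf (c t))}.
  by move=> t01; apply: continuous_comp; [exact: cc|exact/continuous_conf/Uc].
have cL : {within `[0, 1], continuous L}.
  apply: continuous_in_subspaceT => t; rewrite inE /= in_itv /= => t01.
  have -> : L = (fun t => Num.sqrt (conf (c t) ^+ 2 * dot (derive1 c t) (derive1 c t))).
    by apply/funext => s; rewrite -hyp_norm_sqrt.
  apply: (@continuous_comp _ _ _ (fun t => conf (c t) ^+ 2 * dot (derive1 c t) (derive1
    c t)) Num.sqrt).
    by apply: continuous_mul; [apply: continuous_expn; exact: cconf|exact: cdot].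
  exact: sqrt_continuous.
have iL : (@lebesgue_measure R).-integrable `[0, 1] (EFin \o L).
  by apply: continuous_compact_integrable => //; exact: segment_compact.
suff key e : 0 < e -> arcosh (cosh_dist y x + e) - arcosh (1 + e) <= riem_length
  hyp_metric c.
  apply/ler_addgt0Pr => e e0.
  have [d d0 hd] : exists2 d, 0 < d & arcosh (1 + d) <= e.
    have := @continuous_arcosh R 1 (lexx _).
    move=> /cvgrPdist_le/(_ e e0); rewrite arcosh1 => /nbhs_ballP[r /= r0 hr].
    exists (r / 2); first by rewrite divr_gt0.
    have := hr (1 + r / 2);
      rewrite /ball /= opprD addNKr normrN sub0r normrN gtr0_norm ?divr_gt0//.
    move=> h; apply: le_trans (ler_norm _) (h _).
    by rewrite gtr_pMr// invf_lt1// ltr1n.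
  rewrite -lerBlDr; apply: le_trans (key d d0).
  have P1 : 1 <= cosh_dist y x by rewrite -c0; apply: cosh_dist_ge1 => //; apply: Uc;
    rewrite lexx ler01.
  by rewrite lerB// arcosh_le// lerDl ltW.
move=> e0.
pose phi t := arcosh (cosh_dist y (c t) + e).
pose dphi t := (sh (cosh_dist y (c t) + e))^-1 * (conf (c t) ^+ 2 * dot (pole_field y
  (c t)) (derive1 c t)).
have hphi (t : R) : 0 <= t <= 1 -> is_derive t 1 phi (dphi t).
  move=> /Uc ht.
  have P1 := cosh_dist_ge1 hy ht.
  have h := is_derive_add (is_derive_cosh_dist hy (hc t) ht) (is_derive_const e t 1).
  have P1e : 1 < cosh_dist y (c t) + e by rewrite ltr_pwDr.
  have h' := is_derive_comp (g := fun t => cosh_dist y (c t) + e) (is_derive_arcosh P1e) h.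
  by apply: (is_derive_eq h'); rewrite addr0.
have dphiL (t : R) : 0 <= t <= 1 -> `|dphi t| <= L t.
  move=> t01; have ht := Uc _ t01; have P1 := cosh_dist_ge1 hy ht.
  have P1e : 1 < cosh_dist y (c t) + e by rewrite ltr_pwDr.
  have s0 := sh_gt0 P1e; have l0 := conf_gt0 ht.
  rewrite LE// /dphi normrM normfV (gtr0_norm s0) ler_pdivrMl//.
  rewrite normrM [`|conf _ ^+ 2|]ger0_norm ?sqr_ge0//.
  have := dot_pole_field_le hy (derive1 c t) ht => h.
  apply: le_trans (ler_wpM2l (sqr_ge0 (conf (c t))) h) _.
  set q := Num.sqrt _.
  have -> : conf (c t) ^+ 2 * (sh (cosh_dist y (c t)) * (q / conf (c t))) =
     sh (cosh_dist y (c t)) * (conf (c t) * q) by field; rewrite gt_eqF.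
  apply: ler_wpM2r; first by rewrite mulr_ge0 ?sqrtr_ge0// ltW.
  by apply: sh_le => //; rewrite lerDl ltW.
have cdphi : {within `[0, 1], continuous dphi}.
  apply: continuous_in_subspaceT => t; rewrite inE /= in_itv /= => t01.
  have ht := Uc _ t01; have P1 := cosh_dist_ge1 hy ht.
  have P1e : 1 < cosh_dist y (c t) + e by rewrite ltr_pwDr.
  have s0 := sh_gt0 P1e.
  have h1 : {for t, continuous (fun t => (sh (cosh_dist y (c t) + e))^-1)}.
    apply: continuous_inv; first by rewrite gt_eqF.
    apply: (@continuous_comp _ _ _ (fun t => cosh_dist y (c t) + e) sh).
      apply: continuous_add; last exact: continuous_const.
      by apply: continuous_comp; [exact: cc|exact: continuous_cosh_dist].
    exact: continuous_sh.
  have h2 := continuous_expn (k := 2) (cconf _ t01).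
  have h3 : {for t, continuous (fun t => dot (pole_field y (c t)) (derive1 c t))}.
    apply: continuous_dot_comp => i; last exact: cc'i.
    by apply: (@continuous_comp _ _ _ c (fun z => pole_field y z 0 i));
      [exact: cc|exact: continuous_pole_field].
  exact: (continuous_mul h1 (continuous_mul h2 h3)).
have idphi : (@lebesgue_measure R).-integrable `[0, 1] (EFin \o dphi).
  by apply: continuous_compact_integrable => //; exact: segment_compact.
have ftc : (\int[@lebesgue_measure R]_(t in [set` (`[0, 1])%R]) (dphi t)%:E = (phi
  1)%:E - (phi 0)%:E)%E.
  apply: continuous_FTC2 => //.
  - have cphi (t : R) : 0 <= t <= 1 -> {for t, continuous phi}.
      by move=> /hphi h; exact: is_derive_continuous h.
    split.
    + by move=> t; rewrite in_itv /= => /andP[t0 t1]; have [] := hphi t;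
      rewrite // (ltW t0) (ltW t1).
    + by apply/cvg_at_right_filter/cphi; rewrite lexx ler01.
    + by apply/cvg_at_left_filter/cphi; rewrite lexx ler01.
  - move=> t; rewrite in_itv /= => /andP[t0 t1]; rewrite derive1E.
    by have [] := hphi t; rewrite // (ltW t0) (ltW t1).
have -> : arcosh (cosh_dist y x + e) - arcosh (1 + e) = - (\int[@lebesgue_measure R]_(t
  in `[0, 1]) dphi t).
  by rewrite /Rintegral ftc /= /phi c0 c1 cosh_dist_pole opprB.
apply: le_trans (ler_norm _) _; rewrite normrN.
apply: le_trans (le_normr_Rintegral _ idphi) _ => //.
apply: le_Rintegral => //.
exact: integrable_norm idphi.
Qed.

(** The first alternative covers an infimum over the empty set, so that the
existence of curves from [x] to [y] is not at stake. *)
Lemma hyp_dist_ge x y : hyp_space R n y ->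
  hyp_dist x y = 0 \/ arcosh (cosh_dist y x) <= hyp_dist x y.
Proof.
move=> hy; rewrite /hyp_dist /riem_dist; set A := (X in inf X).
have [->|A0] := eqVneq A set0; first by left; rewrite inf0.
right; apply: lb_le_inf; first exact/set0P.
by move=> _ [c hc <-]; exact: arcosh_cosh_dist_le_length.
Qed.

End distance.

(** * Hyperbolic integrals *)

(** Monotonicity for possibly nonmeasurable functions, to be applied to the
geodesic distance: the integral of a nonnegative function is a supremum over the
simple functions below it. *)
Lemma le_integral_ge0 d (T : measurableType d) (R : realType)
  (mu : {measure set T -> \bar R}) (f g : T -> \bar R) :
  (forall x, (0 <= f x)%E) -> (forall x, (f x <= g x)%E) ->
  (\int[mu]_x f x <= \int[mu]_x g x)%E.
Proof.
move=> f0 fg; rewrite !ge0_integralTE//; last by move=> x; exact: le_trans (fg x).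
apply: ereal_sup_le => _ [h hf <-]; exists h => // x.
exact: le_trans (hf x) (fg x).
Qed.

Section hyperbolic_integrals.
Context {R : realType} {n : nat}.
Implicit Types x : 'rV[R]_n.

Lemma hyp_volume x : hyp_space R n x ->
  Num.sqrt (\det (hyp_metric x)) = conf x ^+ n.
Proof.
move=> /conf_gt0 l0; rewrite /hyp_metric det_scalar -/(conf x) -exprM mulnC exprM.
by rewrite sqrtr_sqr ger0_norm// exprn_ge0// ltW.
Qed.

Lemma hyp_integralE (f F : 'rV[R]_n -> R) :
  (forall x, hyp_space R n x -> F x = f x * conf x ^+ n) ->
  (forall x, ~ hyp_space R n x -> F x = 0) ->
  hyp_integral f = (\int[@lebesgue_tuple R n]_t (F (vec_of_tuple t))%:E)%E.
Proof.
move=> Ff F0; rewrite /hyp_integral /riem_integral integral_mkcond.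
apply: eq_integral => t _; rewrite patchE.
case: ifPn => [|]; first by rewrite inE /= => ht; rewrite hyp_volume// Ff.
by rewrite notin_setE /= => /F0 ->.
Qed.

Lemma hyp_norm_grad (u : 'rV[R]_n -> R) x : hyp_space R n x ->
  hyp_norm x (hyp_grad u x) =
  Num.sqrt (dot (\row_i partial i u x) (\row_i partial i u x)) / conf x.
Proof.
move=> hx; have l0 := conf_gt0 hx; have ln0 : conf x != 0 by rewrite gt_eqF.
rewrite hyp_normE// /hyp_grad /riem_grad /hyp_metric -/(conf x) invmx_scalar.
rewrite mul_mx_scalar dotZl dotZr mulrA -expr2 sqrtrM ?sqr_ge0//.
rewrite sqrtr_sqr ger0_norm ?invr_ge0 ?sqr_ge0//.
by field.
Qed.

Lemma hyp_distxx x : hyp_space R n x -> hyp_dist x x = 0.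
Proof.
move=> hx; rewrite /hyp_dist /riem_dist; set A := (X in inf X).
have A0 : A 0.
  exists (cst x); last first.
    rewrite /riem_length; under eq_Rintegral => t _.
      have -> : riem_norm hyp_metric (cst x t) (derive1 (cst x) t) = 0.
        rewrite derive1_cst -/(hyp_norm _ _) hyp_norm_sqrt /dot big1 ?mulr0 ?sqrtr0//
          => i _.
        by rewrite mxE mul0r.
      over.
    by rewrite /Rintegral integral0.
  split=> //.
  - have -> : derive1 (cst x) = cst 0 by apply/funext => t; rewrite derive1_cst.
    by move=> t; exact: cvg_cst.
have lA : lbound A 0.
  move=> _ [c hc <-]; have := arcosh_cosh_dist_le_length hx hc.
  by rewrite cosh_dist_pole arcosh1.
apply/eqP; rewrite eq_le; apply/andP; split.
  by apply: ge_inf => //; exists 0.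
by apply: lb_le_inf => //; exists 0.
Qed.

Lemma cosh_dist_gt1 (y x : 'rV[R]_n) : hyp_space R n y -> hyp_space R n x -> x != y ->
  1 < cosh_dist y x.
Proof.
move=> hy hx xy; rewrite ltrDl divr_gt0//; last by rewrite mulr_gt0// subr_gt0.
rewrite mulr_gt0// lt_neqAle sqnorm2_ge0 andbT eq_sym; apply: contra_neq xy => h.
apply/rowP => i; apply/eqP; rewrite -subr_eq0 -sqrf_eq0.
have : sqnorm2 (x - y) == 0 by rewrite h.
rewrite /sqnorm2 psumr_eq0 => [/allP/(_ i)|j _]; last exact: sqr_ge0.
by rewrite mem_index_enum !mxE; exact.
Qed.

Section cutoff_limit.
Variables (y : 'rV[R]_n) (F : 'rV[R]_n -> R).
Hypothesis hy : hyp_space R n y.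
Hypothesis F_ge0 : forall x, 0 <= F x.
Hypothesis F_out : forall x, ~ hyp_space R n x -> F x = 0.
Hypothesis cF : forall m, continuous (fun x => cutoff m (cosh_dist y x) * F x).
Local Notation mu := (@lebesgue_tuple R n).

(** Monotone convergence; the limit loses the value at the pole, where every
cutoff vanishes. *)
Lemma cvg_integral_cutoff :
  (\int[mu]_t (cutoff m (cosh_dist y (vec_of_tuple t)) * F (vec_of_tuple t))%:E)%E @[m
    --> \oo]
   --> (\int[mu]_t (if vec_of_tuple t == y then 0 else F (vec_of_tuple t))%:E)%E.
Proof.
have E t : (if vec_of_tuple t == y then 0 else F (vec_of_tuple t))%:E =
    limn (fun m => (cutoff m (cosh_dist y (vec_of_tuple t)) * F (vec_of_tuple t))%:E).
  apply/esym/cvg_lim => //; apply/cvg_EFin; first by near=> m.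
  have [hx|hx] := pselect (hyp_space R n (vec_of_tuple t)); last first.
    rewrite (F_out hx) if_same; under eq_fun do rewrite /= mulr0; exact: cvg_cst.
  case: eqP => [->|/eqP xy].
    rewrite /= cosh_dist_pole.
    under eq_fun do rewrite /= cutoff_eq0 ?mul0r ?lerDl//; exact: cvg_cst.
  rewrite -[X in _ --> X]mul1r; apply: cvgM; last exact: cvg_cst.
  by apply: cvg_cutoff; exact: cosh_dist_gt1.
have -> : (\int[mu]_t (if vec_of_tuple t == y then 0 else F (vec_of_tuple t))%:E)%E =
    (\int[mu]_t limn (fun m => (cutoff m (cosh_dist y (vec_of_tuple t)) * F
      (vec_of_tuple t))%:E))%E.
  by apply: eq_integral => t _; exact: E.
apply: cvg_monotone_convergence => //.
- move=> m; have h : continuous (fun x => cutoff m (cosh_dist y x) * F x) := @cF m.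
  by have /measurable_EFinP := measurable_continuous_tuple h.
- by move=> m t _; rewrite lee_fin mulr_ge0// cutoff_ge0.
- move=> t _ m k mk; rewrite lee_fin.
  have [hx|hx] := pselect (hyp_space R n (vec_of_tuple t)); last by rewrite F_out// !mulr0.
  by rewrite ler_wpM2r// nondecreasing_cutoff// cosh_dist_ge1.
Unshelve. all: by end_near. Qed.

End cutoff_limit.

End hyperbolic_integrals.

(** * The Poincare-Hardy inequality *)

Lemma continuous_cutoff_arcoshV (R : realType) (p : R) m :
  continuous (fun s : R => cutoff m s * (arcosh s)^-1 `^ p).
Proof.
move=> s; have [s1|s1] := ltP 1 s.
  have r0 : 0 < (arcosh s)^-1 by rewrite invr_gt0 arcosh_gt0.
  have h := is_derive_mul (is_derive_cutoff m s)
    (is_derive_comp (g := fun s => (arcosh s)^-1) (is_derive1_powR p r0)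
      (is_derive_arcoshV s1)).
  exact: is_derive_continuous h.
apply: (near_cst_continuous (0 : R)); near=> z.
rewrite cutoff_eq0 ?mul0r//; near: z; apply: lt_le_nbhsl.
by rewrite (le_lt_trans s1)// ltrDl invr_gt0.
Unshelve. all: by end_near. Qed.

Section assembly.
Context {R : realType} {n : nat}.
Variables (p : R) (y : 'rV[R]_n) (u : 'rV[R]_n -> R).
Hypothesis p2 : 2 <= p.
Hypothesis np : 1 + p * (p - 1) <= n%:R.
Hypothesis hy : hyp_space R n y.
Hypothesis hu : test_function (hyp_space R n) u.
Implicit Types x : 'rV[R]_n.
Local Notation mu := (@lebesgue_tuple R n).
Local Notation T := (@vec_of_tuple R n).

Let a : R := (n%:R - 1) / p.
Let p0 : 0 < p. Proof. by move: p2; lra. Qed.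
Let pa : p - 1 <= a.
Proof. by rewrite /a ler_pdivlMr//; move: np; rewrite mulrC; lra. Qed.
(* the dimension enters the radial inequality through [p * a = n - 1] *)
Let nE : n%:R = p * a + 1. Proof. by rewrite /a; field; rewrite gt_eqF. Qed.
Let Lam := a `^ p.
Let C := (p - 1) * a `^ (p - 2) * ((p - 1) / p) ^+ 2.
Let C0 : 0 <= C.
Proof. by rewrite /C mulr_ge0 ?sqr_ge0// mulr_ge0 ?powR_ge0//; move: p2; lra. Qed.

Let Lam0 : 0 <= Lam. Proof. exact: powR_ge0. Qed.

Let out x : ~ hyp_space R n x -> ~ supp u x.
Proof. by move=> hx /(supp_ball hu). Qed.

Let cube_out x : ~ in_cube 1 n x -> ~ supp u x.
Proof. exact: supp_cube. Qed.

Let partial0 i x : ~ supp u x -> partial i u x = 0.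
Proof.
move=> nx; have h : is_derive x (delta_mx 0 i) u 0.
  apply: (is_derive_near _ (is_derive_const 0 x _)).
  near=> z; apply: supp0; near: z; exact: near_supp0.
by have [_ <-] := h.
Unshelve. all: by end_near. Qed.

Let grad2 x := dot (\row_i partial i u x) (\row_i partial i u x).
Let grad20 x : ~ supp u x -> grad2 x = 0.
Proof. by move=> h; apply: big1 => i _; rewrite !mxE partial0// mul0r. Qed.

(* The integrands, multiplied by the volume density and extended by zero outside
   of the ball: [FA] of the gradient, [FB] of [|u|^p], [FR] of [|u|^p / rho^p]. *)
Let FA x := (conf x ^+ n * powabs p (conf x)^-1) * powabs p (Num.sqrt (grad2 x)).
Let FB x := conf x ^+ n * powabs p (u x).
Let FR x := conf x ^+ n * (arcosh (cosh_dist y x))^-1 `^ p * powabs p (u x).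

Let powabs0 x : ~ supp u x -> powabs p (u x) = 0.
Proof. by move=> /supp0 ->; rewrite /powabs normr0 powR0// gt_eqF. Qed.

Let FA0 x : ~ supp u x -> FA x = 0.
Proof.
by move=> /grad20 h; rewrite /FA h sqrtr0 /powabs normr0 [0 `^ p]powR0 ?mulr0// gt_eqF.
Qed.
Let FB0 x : ~ supp u x -> FB x = 0.
Proof. by move=> /powabs0 h; rewrite /FB h mulr0. Qed.
Let FR0 x : ~ supp u x -> FR x = 0.
Proof. by move=> /powabs0 h; rewrite /FR h mulr0. Qed.

Let FB_ge0 x : 0 <= FB x.
Proof.
have [hx|/out/FB0 ->//] := pselect (hyp_space R n x).
by rewrite mulr_ge0 ?powR_ge0// exprn_ge0// ltW// conf_gt0.
Qed.
Let FR_ge0 x : 0 <= FR x.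
Proof.
have [hx|/out/FR0 ->//] := pselect (hyp_space R n x).
by rewrite mulr_ge0 ?powR_ge0// mulr_ge0 ?powR_ge0// exprn_ge0// ltW// conf_gt0.
Qed.

Let continuous_powabs_u : continuous (fun x => powabs p (u x)).
Proof.
move=> x; apply: continuous_comp; last exact: (continuous_powabs p2).
exact: (continuous_test hu).
Qed.

Let cFA : continuous FA.
Proof.
apply: (continuous_mul_support (@closed_supp _ _ u) (supp_ball hu)).
- move=> x hx; have cx := continuous_conf hx.
  apply: continuous_mul; first exact: continuous_expn.
  apply: continuous_comp; last exact: (continuous_powabs p2).
  by apply: continuous_inv => //; rewrite gt_eqF// conf_gt0.
- have cg x : {for x, continuous grad2}.
    apply: continuous_sumR => i.
    have h : {for x, continuous (fun z => (\row_i partial i u z) 0 i)}.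
      have -> : (fun z => (\row_i partial i u z) 0 i) = partial i u by apply/funext => z;
        rewrite mxE.
      exact: (continuous_partial hu).
    exact: continuous_mul.
  move=> x; apply: (@continuous_comp _ _ _ (fun x => Num.sqrt (grad2 x)) (powabs p));
    last exact: (continuous_powabs p2).
  by apply: (@continuous_comp _ _ _ grad2 Num.sqrt); [exact: cg|exact: sqrt_continuous].
- by move=> x /grad20 ->; rewrite sqrtr0 /powabs normr0 powR0// gt_eqF.
Qed.

Let cFB : continuous FB.
Proof.
apply: (continuous_mul_support (@closed_supp _ _ u) (supp_ball hu)) => //.
by move=> x hx; apply: continuous_expn; exact: continuous_conf.
Qed.

Let cFBm m : continuous (fun x => cutoff m (cosh_dist y x) * FB x).
Proof.
have -> : (fun x => cutoff m (cosh_dist y x) * FB x) =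
  (fun x => (cutoff m (cosh_dist y x) * conf x ^+ n) * powabs p (u x)).
  by apply/funext => x; rewrite mulrA.
apply: (continuous_mul_support (@closed_supp _ _ u) (supp_ball hu)) => // x hx.
apply: continuous_mul; last by apply: continuous_expn; exact: continuous_conf.
apply: continuous_comp; first exact: continuous_cosh_dist.
exact: is_derive_continuous (is_derive_cutoff m _).
Qed.

Let cFRm m : continuous (fun x => cutoff m (cosh_dist y x) * FR x).
Proof.
have -> : (fun x => cutoff m (cosh_dist y x) * FR x) =
  (fun x => (conf x ^+ n * (cutoff m (cosh_dist y x) * (arcosh (cosh_dist y x))^-1 `^ p))
     * powabs p (u x)).
  by apply/funext => x; rewrite /FR; ring.
apply: (continuous_mul_support (@closed_supp _ _ u) (supp_ball hu)) => // x hx.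
apply: continuous_mul; first by apply: continuous_expn; exact: continuous_conf.
apply: (@continuous_comp _ _ _ (cosh_dist y) (fun s => cutoff m s * (arcosh s)^-1 `^ p)).
  exact: continuous_cosh_dist.
exact: continuous_cutoff_arcoshV.
Qed.

Let dv m := div_test y (weight p a m) (dweight p a m) p u.

Let pointwise m x :
  Lam * (cutoff m (cosh_dist y x) * FB x) + C * (cutoff m (cosh_dist y x) * FR x)
    <= FA x + dv m x.
Proof.
have [hx|hx] := pselect (hyp_space R n x); last first.
  have ns := out hx.
  rewrite FA0// FB0// FR0// /dv /div_test powabs0// (supp0 ns) /dpowabs sgr0.
  by rewrite !(mulr0, mul0r, addr0).
have l0 := conf_gt0 hx; have P1 := cosh_dist_ge1 hy hx.
set g := Num.sg (u x) * dot (pole_field y x) (\row_i partial i u x).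
set z := Num.sqrt (grad2 x) / conf x.
have z0 : 0 <= z by rewrite divr_ge0 ?sqrtr_ge0// ltW.
have hg : `|g| <= sh (cosh_dist y x) * z.
  apply: le_trans (dot_pole_field_le hy _ hx).
  rewrite normrM normr_sg; case: (u x == 0) => /=; first by rewrite mul0r normr_ge0.
  by rewrite mul1r.
have h := weight_pointwise p2 pa m P1 (normr_ge0 (u x)) z0 hg.
have {}h := ler_wpM2l (exprn_ge0 n (ltW l0)) h.
have -> : Lam * (cutoff m (cosh_dist y x) * FB x) + C * (cutoff m (cosh_dist y x) * FR x) =
  conf x ^+ n * (cutoff m (cosh_dist y x) *
   ((a `^ p + (p - 1) * a `^ (p - 2) * ((p - 1) / p) ^+ 2 * (arcosh (cosh_dist y x))^-1
     `^ p) * `|u x| `^ p)).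
  by rewrite /FB /FR /Lam /C /powabs; ring.
apply: le_trans h _; rewrite le_eqVlt; apply/orP; left; apply/eqP.
have zE : z `^ p = powabs p (conf x)^-1 * powabs p (Num.sqrt (grad2 x)).
  rewrite /powabs [`|_^-1|]ger0_norm ?invr_ge0 ?ltW// [`|Num.sqrt _|]ger0_norm ?sqrtr_ge0//.
  by rewrite -powRM ?invr_ge0 ?sqrtr_ge0 ?ltW// mulrC.
rewrite zE /FA /dv /div_test nE /g /dpowabs /powabs; ring.
Qed.

Let integrable_F (F : 'rV[R]_n -> R) : continuous F -> (forall x, ~ supp u x -> F x = 0) ->
  mu.-integrable [set: _] (fun t => (F (T t))%:E).
Proof.
by move=> cF F0; apply: (@integrable_continuous_cube _ _ 1) => // x /cube_out/F0.
Qed.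

Let cutoff_inequality m :
  (Lam%:E * \int[mu]_t (cutoff m (cosh_dist y (T t)) * FB (T t))%:E
    + C%:E * \int[mu]_t (cutoff m (cosh_dist y (T t)) * FR (T t))%:E
   <= \int[mu]_t (FA (T t))%:E)%E.
Proof.
have cW (x : R) : is_derive x 1 (weight p a m) (dweight p a m x) by exact: is_derive_weight.
have cdW : continuous (dweight p a m) by exact: continuous_dweight.
have iA := integrable_F cFA FA0.
have iB : mu.-integrable [set: _] (fun t => (cutoff m (cosh_dist y (T t)) * FB (T t))%:E).
  by apply: (integrable_F (@cFBm m)) => x /FB0 ->; rewrite mulr0.
have iR : mu.-integrable [set: _] (fun t => (cutoff m (cosh_dist y (T t)) * FR (T t))%:E).
  by apply: (integrable_F (@cFRm m)) => x /FR0 ->; rewrite mulr0.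
have idv : mu.-integrable [set: _] (fun t => (dv m (T t))%:E).
  apply: (@integrable_continuous_cube _ _ 1).
    exact: (continuous_div_test hy cW cdW p2 hu).
  by move=> x; exact: (div_test0 _ _ hy p2 hu).
have I0 : (\int[mu]_t (dv m (T t))%:E = 0)%E by exact: (integral_div_test hy cW cdW p2 hu).
rewrite -!integralZl// -integralD//; [|exact: integrableZl..].
rewrite -[leRHS]adde0 -I0 -integralD//.
apply: le_integral_ge0 => t.
  rewrite -!EFinM -EFinD lee_fin.
  by apply: addr_ge0; apply: mulr_ge0 => //; apply: mulr_ge0 => //; exact: cutoff_ge0.
by rewrite -!EFinM -!EFinD lee_fin pointwise.
Qed.

(** The inequality with the explicit function [arcosh (cosh_dist y x)] instead of
the geodesic distance. *)
Lemma poincare_hardy_arcosh :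
  (Lam%:E * \int[mu]_t (FB (T t))%:E + C%:E * \int[mu]_t (FR (T t))%:E
   <= \int[mu]_t (FA (T t))%:E)%E.
Proof.
have cB := cvg_integral_cutoff hy FB_ge0 (fun x nx => FB0 (out nx)) cFBm.
have cR := cvg_integral_cutoff hy FR_ge0 (fun x nx => FR0 (out nx)) cFRm.
have eR : (\int[mu]_t (if T t == y then 0 else FR (T t))%:E = \int[mu]_t (FR (T t))%:E)%E.
  apply: eq_integral => t _; case: eqP => [->|//].
  by rewrite /FR cosh_dist_pole arcosh1 invr0 powR0 ?mulr0 ?mul0r// gt_eqF.
have eB : (\int[mu]_t (if T t == y then 0 else FB (T t))%:E = \int[mu]_t (FB (T t))%:E)%E.
  pose t0 : n.-tuple (measurableTypeR R) := [tuple y 0 i | i < n].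
  have Tt0 t : (T t == y) = (t == t0).
    apply/eqP/eqP => [h|->]; last by apply/rowP => i; rewrite mxE tnth_mktuple.
    by apply: eq_from_tnth => i; rewrite tnth_mktuple -h mxE.
  have n0 : (0 < n)%N.
    by rewrite -(ltr_nat R); apply: lt_le_trans np; rewrite ltr_pwDl// mulr_ge0//;
      move: p2; lra.
  have [mt t00] : measurable [set t0] /\ mu [set t0] = 0%E.
    by split; [exact: measurable_set1_tuple|exact: lebesgue_tuple_set1].
  rewrite [RHS](negligible_integral mt measurableT (integrable_F cFB FB0) t00).
  rewrite [RHS]integral_mkcond; apply: eq_integral => t _; rewrite patchE Tt0.
  case: eqP => [->|tt0]; case: ifPn => //; first by rewrite inE => -[_ []].
  by rewrite notin_setE => -[]; split.
rewrite eR in cR; rewrite eB in cB.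
have Ige0 F : (forall x, 0 <= F x) -> (0 <= \int[mu]_t (F (T t))%:E)%E.
  by move=> F0; apply: integral_ge0 => t _; rewrite lee_fin.
have LB0 : (0 <= Lam%:E * \int[mu]_t (FB (T t))%:E)%E by rewrite mule_ge0// Ige0.
have CR0 : (0 <= C%:E * \int[mu]_t (FR (T t))%:E)%E by rewrite mule_ge0// Ige0.
have cv : (Lam%:E * \int[mu]_t (cutoff m (cosh_dist y (T t)) * FB (T t))%:E
    + C%:E * \int[mu]_t (cutoff m (cosh_dist y (T t)) * FR (T t))%:E)%E @[m --> \oo] -->
    (Lam%:E * \int[mu]_t (FB (T t))%:E + C%:E * \int[mu]_t (FR (T t))%:E)%E.
  by apply: cvgeD; [exact: ge0_adde_def|exact: cvgeZl|exact: cvgeZl].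
rewrite -(cvg_lim _ cv)//.
apply: lime_le; first exact: (cvgP _ cv).
by apply: nearW => m; exact: cutoff_inequality.
Qed.

Lemma poincare_hardy :
  (C%:E * hyp_integral (fun x => `|u x| `^ p / hyp_dist x y `^ p)%R
   <= hyp_integral (fun x => hyp_norm x (hyp_grad u x) `^ p)%R
     - Lam%:E * hyp_integral (fun x => `|u x| `^ p)%R)%E.
Proof.
have eA : hyp_integral (fun x => hyp_norm x (hyp_grad u x) `^ p) = (\int[mu]_t (FA (T
  t))%:E)%E.
  apply: hyp_integralE => [x hx|x /out/FA0//].
  have l0 := conf_gt0 hx.
  rewrite hyp_norm_grad// powRM ?sqrtr_ge0 ?invr_ge0 ?ltW// /FA /powabs.
  rewrite [`|_^-1|]ger0_norm ?invr_ge0 ?ltW// [`|Num.sqrt _|]ger0_norm ?sqrtr_ge0//.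
  by rewrite /grad2; ring.
have eB : hyp_integral (fun x => `|u x| `^ p) = (\int[mu]_t (FB (T t))%:E)%E.
  apply: hyp_integralE => [x hx|x /out/FB0//].
  by rewrite /FB /powabs mulrC.
pose J x := `|u x| `^ p / hyp_dist x y `^ p * conf x ^+ n.
have eJ : hyp_integral (fun x => `|u x| `^ p / hyp_dist x y `^ p) = (\int[mu]_t (J (T
  t))%:E)%E.
  apply: hyp_integralE => // x /out/supp0 ux.
  by rewrite /J ux normr0 powR0 ?mul0r// gt_eqF.
have JR x : 0 <= J x <= FR x.
  have [hx|/out hx] := pselect (hyp_space R n x); last first.
    by rewrite FR0// /J (supp0 hx) normr0 powR0 ?mul0r ?lexx// gt_eqF.
  have l0 := conf_gt0 hx; have ln0 : 0 <= conf x ^+ n by rewrite exprn_ge0// ltW.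
  rewrite /J /FR /powabs; apply/andP; split;
    first by rewrite mulr_ge0// divr_ge0// powR_ge0.
  set U := `|u x| `^ p; set q := (hyp_dist x y `^ p)^-1; set r := _^-1 `^ p.
  rewrite (_ : U * q * conf x ^+ n = conf x ^+ n * U * q); last by ring.
  rewrite (_ : conf x ^+ n * r * U = conf x ^+ n * U * r); last by ring.
  apply: ler_wpM2l; first by rewrite mulr_ge0// powR_ge0.
  rewrite /r /q.
  have r0 : 0 <= (arcosh (cosh_dist y x))^-1 `^ p by exact: powR_ge0.
  have pn0 : p != 0 by rewrite gt_eqF.
  have zero : hyp_dist x y = 0 -> (hyp_dist x y `^ p)^-1 <= (arcosh (cosh_dist y x))^-1
    `^ p.
    by move=> ->; rewrite (powR0 pn0) invr0.
  have [xy|xy] := eqVneq x y; first by apply: zero; rewrite xy; exact: hyp_distxx.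
  have [/zero//|h] := hyp_dist_ge x hy.
  have a0 : 0 < arcosh (cosh_dist y x) by apply/arcosh_gt0/cosh_dist_gt1.
  have d0 : 0 < hyp_dist x y := lt_le_trans a0 h.
  have -> : (hyp_dist x y `^ p)^-1 = (hyp_dist x y)^-1 `^ p.
    rewrite -(powR_inv1 (powR_ge0 _ _)) -powRrM mulrC powRrM.
    by rewrite (powR_inv1 (ltW d0)).
  by apply: le_powRl; [exact: ltW|rewrite invr_ge0 ltW|rewrite lef_pV2].
rewrite eA eB eJ leeBrDl; last first.
  by rewrite fin_numM//; apply: integrable_fin_num => //; exact: integrable_F cFB FB0.
apply: le_trans poincare_hardy_arcosh; apply: leeD => //.
apply: lee_wpmul2l; first by rewrite lee_fin.
by apply: le_integral_ge0 => t; rewrite lee_fin; have /andP[] := JR (T t).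
Qed.

End assembly.

Theorem theorem2p3 (R : realType) (p : R) (N : nat)
  (hp : 2 <= p) (hN : 1 + p * (p - 1) <= N%:R)
  (x0 : 'rV[R]_N) (hx0 : hyp_space R N x0)
  (u : 'rV[R]_N -> R) (hu : test_function (hyp_space R N) u) :
  let Lambda_p := ((N%:R - 1) / p) `^ p in
  let r := fun x => hyp_dist x x0 in
  (hyp_integral (fun x => hyp_norm x (hyp_grad u x) `^ p)%R
     - Lambda_p%:E * hyp_integral (fun x => `|u x| `^ p)%R
   >= ((p - 1) * ((N%:R - 1) / p) `^ (p - 2) * ((p - 1) / p) ^+ 2)%R%:E
      * hyp_integral (fun x => `|u x| `^ p / r x `^ p)%R)%E.
Proof.
exact: (poincare_hardy hp hN hx0 hu).
Qed.
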